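(* Let $n>1$ be an odd integer and let $r\geqslant 1$. Then, modulo $[n^r]\prod_{j=1}^r\Phi_{n^j}(q)^2$, \begin{align*} \sum_{k=0}^{(n^r-1)/2} q^{k^2}[6k+1]\frac{(q;q^2)_k^2 (q^2;q^4)_k }{(q^4;q^4)_k^3} &\equiv (-q)^{(1-n)/2}[n]\sum_{k=0}^{(n^{r-1}-1)/2} q^{nk^2}[6k+1]_{q^n}\frac{(q^n;q^{2n})_k^2 (q^{2n};q^{4n})_k }{(q^{4n};q^{4n})_k^3},\\ \sum_{k=0}^{n^r-1} q^{k^2}[6k+1]\frac{(q;q^2)_k^2 (q^2;q^4)_k }{(q^4;q^4)_k^3} &\equiv (-q)^{(1-n)/2}[n]\sum_{k=0}^{n^{r-1}-1} q^{nk^2}[6k+1]_{q^n}\frac{(q^n;q^{2n})_k^2 (q^{2n};q^{4n})_k }{(q^{4n};q^{4n})_k^3}. \end{align*}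
   Context: Notation: $(a;q)_k=(1-a)(1-aq)\cdots(1-aq^{k-1})$ (with $(a;q)_0=1$) is the $q$-shifted factorial; $[m]=[m]_q=1+q+\cdots+q^{m-1}$ is the $q$-integer, and $[m]_{q^n}=1+q^n+\cdots+q^{n(m-1)}$. $\Phi_m(q)$ denotes the $m$-th cyclotomic polynomial in $q$. For rational functions $A(q),B(q)$ and a polynomial $P(q)$, $A\equiv B\pmod{P}$ means that $A-B$ can be written as a quotient of polynomials whose numerator is divisible by $P(q)$ and whose denominator is relatively prime to $P(q)$. *)

(* Defs.v *)
From HB Require Import structures.
From mathcomp Require Import all_boot all_order all_algebra all_field fraction.
Set Implicit Arguments. Unset Strict Implicit. Unset Printing Implicit Defensive.
Import Order.TTheory GRing.Theory Num.Theory.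
Local Open Scope ring_scope.

Definition qpoch (R : pzRingType) (a q : R) (k : nat) : R :=
  \prod_(i < k) (1 - a * q ^+ i).

Definition qint (R : pzRingType) (q : R) (m : nat) : R :=
  \sum_(i < m) q ^+ i.

Definition RF := {fraction {poly rat}}.

Definition toRF (p : {poly rat}) : RF := @FracField.tofrac _ p.

Definition qX : RF := toRF 'X.

Definition Phi (m : nat) : {poly rat} := map_poly intr ('Phi_m).

Definition qcong (A B : RF) (P : {poly rat}) : Prop :=
  exists (N D : {poly rat}),
    [/\ D != 0, P %| N, coprimep D P & A - B = toRF N / toRF D].

Definition summand (q : RF) (k : nat) : RF :=
  q ^+ (k ^ 2) * qint q (6 * k + 1)
  * (qpoch q (q ^+ 2) k) ^+ 2 * qpoch (q ^+ 2) (q ^+ 4) k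
  / (qpoch (q ^+ 4) (q ^+ 4) k) ^+ 3.

(* Main.v *)
Require Import Defs.
From HB Require Import structures.
From mathcomp Require Import all_boot all_order all_algebra all_field fraction.
From mathcomp Require Import ring zify.
Import Order.TTheory GRing.Theory Num.Theory.
Local Open Scope ring_scope.
Set Implicit Arguments. Unset Strict Implicit. Unset Printing Implicit Defensive.

(** Replace [(q;q^2)_k^2 / (q^4;q^4)_k^2] by the product of
    [rho b (q^(2i+1)) / rho b (q^(4i+4))], [rho b Q = 1 + Q^2 - b Q]; writing
    [b = a + 1/a] this is the insertion of the parameter [a] of the creative
    microscope, and [b = 2] gives back the original summand.

    - At [b = q^M + q^-M], [M = 2m+1], the sum terminates and equals
      [(-q)^-m [M]] (a WZ certificate in the variable [q^M]).
    - Fix an odd [d > 1] and let [q] specialize to a primitive [d]-th root of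
      unity. For generic [b] the truncated sum vanishes under this
      specialization: the half block [k <= (d-1)/2] by interpolation from the
      exact values at [M = 1, 3, .., d], longer sums by periodicity in [k].
    - Hence, after clearing denominators, the difference of the sum over [q]
      and [(-q)^((1-d)/2) [d]] times the sum over [q^d] is a polynomial in [b]
      which vanishes at [M = d, 3d, 5d, ..] and modulo [Phi_d]. At [b = 2] these
      zeros outnumber the denominators by exactly [Phi_d^2], so the difference
      vanishes modulo [Phi_d^3].
    - For [n^j | n^r], comparing both sides of the theorem with the sum over
      [q^(n^j)] gives the congruence modulo [Phi_(n^j)^3]; for the other
      divisors [D > 1] of [n^r] both sides vanish modulo [Phi_D]. *)

(** * Exact evaluation of the terminating sums *)

Definition rho (F : fieldType) (b Q : F) : F := 1 + Q ^+ 2 - b * Q.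

Definition tfac (F : fieldType) (q b : F) (i : nat) : F :=
  rho b (q ^+ (2 * i + 1)) * (1 - q ^+ (4 * i + 2))
  / (rho b (q ^+ (4 * i + 4)) * (1 - q ^+ (4 * i + 4))).

Definition term (F : fieldType) (q b : F) (k : nat) : F :=
  q ^+ (k ^ 2) * qint q (6 * k + 1) * \prod_(i < k) tfac q b i.

(** For odd [m] this is also the exact value of the sum at [b = q^m + q^-m]. *)
Definition cfac (F : fieldType) (q : F) (m : nat) : F :=
  (- q) ^- ((m - 1) %/ 2) * qint q m.

Lemma rhoE (F : fieldType) (y Q : F) :
  y != 0 -> rho (y + y^-1) Q = (1 - y * Q) * (1 - Q / y).
Proof. by move=> y0; rewrite /rho; field. Qed.

Lemma exp_sqrS (F : fieldType) (q : F) k :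
  q ^+ (k.+1 ^ 2) = q ^+ (k ^ 2) * q ^+ k ^+ 2 * q.
Proof.
have -> : (k.+1 ^ 2 = k ^ 2 + k * 2 + 1)%N by rewrite -!mulnn; nia.
by rewrite !exprD exprM expr1.
Qed.

Lemma qintE (F : fieldType) (q : F) m : 1 - q != 0 -> qint q m = (1 - q ^+ m) / (1 - q).
Proof.
move=> q1; apply: (canRL (mulfK q1)).
by rewrite -[RHS]opprB subrX1 mulrC -mulNr opprB.
Qed.

Lemma exp_affine (F : fieldType) (q : F) m k c :
  q ^+ (m * k + c) = q ^+ k ^+ m * q ^+ c.
Proof. by rewrite exprD mulnC exprM. Qed.

Lemma exp_affineS (F : fieldType) (q : F) m k c :
  q ^+ (m * k.+1 + c) = q ^+ k ^+ m * q ^+ (m + c).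
Proof. by rewrite mulnS addnAC addnC exp_affine addnC. Qed.

(* The common factor of the [k]-th summands at [y] and at [y * q ^+ 4]. *)
Definition wz_prod (F : fieldType) (q y : F) (k : nat) : F :=
  \prod_(i < k)
    (((y * q ^+ 3 - q ^+ (2 * i)) / q ^+ 3) * (1 - y * q ^+ (2 * i + 1))
     * (1 - q ^+ (4 * i + 2))
     / ((1 - y * q ^+ (4 * i + 4)) * (y - q ^+ (4 * i + 4))
        * (1 - q ^+ (4 * i + 4)))).

Section WZ.

Variables (F : fieldType) (q y : F).
Hypotheses (q0 : q != 0) (y0 : y != 0) (q1 : 1 - q != 0).
Hypotheses (yq1 : 1 - y * q != 0) (yq3 : 1 - y * q ^+ 3 != 0).
Hypothesis qk : forall k, 1 - q ^+ (4 * k + 4) != 0.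
Hypothesis yqk : forall k, 1 - y * q ^+ (4 * k + 4) != 0.
Hypothesis qky : forall k, y - q ^+ (4 * k) != 0.

Let b := y + y^-1.
Let b' := y * q ^+ 4 + (y * q ^+ 4)^-1.

(** By [rhoE] the two products differ only by [y - q^(2i+1)] against [y - q^(2i-3)]; shifting the
    index by two leaves boundary factors only. *)
Lemma prod_tfac_wz k :
  (\prod_(i < k) tfac q b i) =
  wz_prod q y k * ((y * q ^+ 3 - q ^+ (2 * k)) * (y * q - q ^+ (2 * k)))
   / ((1 - y * q ^+ 3) * (1 - y * q)).
Proof.
elim: k => [|k IH].
  by rewrite /wz_prod !big_ord0 muln0 expr0; field; rewrite yq3 yq1.
rewrite /wz_prod !big_ord_recr /= -/(wz_prod q y k) IH {IH}.
rewrite /tfac !rhoE //.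
have := qk k; have := yqk k; have := qky k.+1.
rewrite mulnS (addnC 4%N).
have -> : q ^+ (2 * k + 1) = q ^+ k ^+ 2 * q by rewrite exp_affine ?expr1.
have -> : q ^+ (2 * k.+1) = q ^+ k ^+ 2 * q ^+ 2.
  by rewrite -[(2 * _)%N]addn0 exp_affineS.
have -> : q ^+ (2 * k) = q ^+ k ^+ 2 by rewrite mulnC exprM.
have -> : q ^+ (4 * k + 4) = (q ^+ k * q) ^+ 4 by rewrite exp_affine exprMn.
have -> : q ^+ (4 * k + 2) = q ^+ k ^+ 4 * q ^+ 2 by rewrite exp_affine ?expr1.
move: (wz_prod q y k) (q ^+ k) => w x h1 h2 h3.
field; by rewrite h1 h3 h2 y0 q0 yq1 yq3 /=.
Qed.

(** Replacing [y] by [y q^4] shifts [1 - y q^(2i+1)] by two indices and the factors with [q^(4i+4)]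
    and [y] by one, so the quotient by [wz_prod] telescopes again. *)
Lemma prod_tfac_shift_wz k :
  (\prod_(i < k) tfac q b' i) =
  wz_prod q y k * ((1 - y * q ^+ (2 * k + 1)) * (1 - y * q ^+ (2 * k + 3))
                   * (1 - y * q ^+ 4) * (y - q ^+ (4 * k)))
   / ((1 - y * q ^+ 3) * (1 - y * q) * (y - 1) * (1 - y * q ^+ (4 * k + 4))).
Proof.
have y1 : y - 1 != 0 by have := qky 0; rewrite muln0.
have y4 : 1 - y * q ^+ 4 != 0 by have := yqk 0; rewrite muln0.
elim: k => [|k IH].
  rewrite /wz_prod !big_ord0 !muln0 !add0n expr0 expr1; field.
  by rewrite y4 yq1 yq3 y1.
rewrite /wz_prod !big_ord_recr /= -/(wz_prod q y k) IH {IH}.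
rewrite /tfac !rhoE ?mulf_neq0 ?expf_neq0 //.
have := qk k; have := yqk k; have := qky k.+1; have := qky k; have := yqk k.+1.
rewrite mulnS (addnC 4%N).
rewrite !exp_affineS.
have -> : q ^+ (2 * k + 1) = q ^+ k ^+ 2 * q by rewrite exp_affine ?expr1.
have -> : q ^+ (2 * k + 3) = q ^+ k ^+ 2 * q ^+ 3 by rewrite exp_affine ?expr1.
have -> : q ^+ (2 * k) = q ^+ k ^+ 2 by rewrite mulnC exprM.
have -> : q ^+ (4 * k) = q ^+ k ^+ 4 by rewrite mulnC exprM.
have -> : q ^+ (4 * k + 4 + 4) = q ^+ k ^+ 4 * q ^+ 8.
  by rewrite -(addnA (4 * k)%N) exp_affine.
have -> : q ^+ (4 * k + 4) = (q ^+ k * q) ^+ 4 by rewrite exp_affine exprMn.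
have -> : q ^+ (4 * k + 2) = q ^+ k ^+ 4 * q ^+ 2 by rewrite exp_affine ?expr1.
move: (wz_prod q y k) (q ^+ k) => w x h0 h1 h2 h3 h4.
field; by rewrite h0 h1 h2 h3 h4 y0 q0 yq1 yq3 y1 /=.
Qed.

(** The right side is the WZ certificate: it vanishes at [n = 0] and its forward difference is the
    summand. The two coefficients on the left encode the ratio of the expected exact values at
    [y q^4] and [y]. *)
Lemma sum_term_wz n :
  \sum_(k < n) (q ^+ 2 * (1 - y) * term q b' k
                - (1 - y * q ^+ 4) * term q b k)
  = q ^+ (n ^ 2) * wz_prod q y n * (1 - q ^+ (4 * n)) * (y - q ^+ (4 * n))
    * (q - q ^+ (2 * n)) * (1 - y * q ^+ 4) * (1 + y * q ^+ 2) * q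
    / ((1 - y * q ^+ 3) * (1 - y * q) * (1 - q)).
Proof.
have y1 : y - 1 != 0 by have := qky 0; rewrite muln0.
elim: n => [|n IH].
  by rewrite big_ord0 muln0 expr0 subrr !mulr0 !mul0r.
rewrite big_ord_recr /= {}IH /term prod_tfac_wz prod_tfac_shift_wz !qintE //.
rewrite exp_sqrS /wz_prod big_ord_recr /= -/(wz_prod q y n).
have := qk n; have := yqk n; have := qky n.+1.
rewrite (mulnS 4) (addnC 4%N).
have -> : q ^+ (6 * n + 1) = q ^+ n ^+ 6 * q by rewrite exp_affine ?expr1.
have -> : q ^+ (2 * n + 1) = q ^+ n ^+ 2 * q by rewrite exp_affine ?expr1.
have -> : q ^+ (2 * n + 3) = q ^+ n ^+ 2 * q ^+ 3 by rewrite exp_affine ?expr1.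
have -> : q ^+ (2 * n.+1) = q ^+ n ^+ 2 * q ^+ 2.
  by rewrite -[(2 * _)%N]addn0 exp_affineS.
have -> : q ^+ (2 * n) = q ^+ n ^+ 2 by rewrite mulnC exprM.
have -> : q ^+ (4 * n) = q ^+ n ^+ 4 by rewrite mulnC exprM.
have -> : q ^+ (4 * n + 4) = (q ^+ n * q) ^+ 4 by rewrite exp_affine exprMn.
have -> : q ^+ (4 * n + 2) = q ^+ n ^+ 4 * q ^+ 2 by rewrite exp_affine ?expr1.
move: (wz_prod q y n) (q ^+ n) (q ^+ (n ^ 2)) => w x v h2 h3 h4.
field; by rewrite h2 h3 h4 q0 yq1 yq3 y1 q1 /=.
Qed.

End WZ.

Section Exact.

Variables (F : fieldType) (q : F).
Hypotheses (q0 : q != 0) (qn1 : forall i, (0 < i)%N -> q ^+ i != 1).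

Let q1 : 1 - q != 0.
Proof. by rewrite subr_eq0 eq_sym (qn1 (ltn0Sn 0)). Qed.

Lemma sub_exp_neq0 i j : (i != j)%N -> q ^+ i - q ^+ j != 0.
Proof.
wlog lt_ij : i j / (i < j)%N => [H|] ne_ij.
  have [/H|/H|/eqP] := ltngtP i j; first exact.
    by rewrite eq_sym -opprB oppr_eq0; apply.
  by rewrite (negbTE ne_ij).
rewrite -(subnKC (ltnW lt_ij)) exprD -{1}[q ^+ i]mulr1 -mulrBr.
by rewrite mulf_neq0 ?expf_neq0 // subr_eq0 eq_sym qn1 // subn_gt0.
Qed.

Lemma sum_term_rho0 b m N : (m <= N)%N -> rho b (q ^+ (2 * m + 1)) = 0 ->
  \sum_(k < N.+1) term q b k = \sum_(k < m.+1) term q b k.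
Proof.
move=> le_mN b0; rewrite -!(big_mkord xpredT).
rewrite (big_cat_nat (leq0n m.+1)) //= -[RHS]addr0; congr (_ + _).
rewrite big_nat_cond big1 // => k /andP[/andP[lt_mk _] _].
by rewrite /term (bigD1 (Ordinal lt_mk)) //= /tfac b0 !mul0r mulr0.
Qed.

(* Consecutive odd [M] are not hypergeometrically related, hence the step
   from [M] to [M + 4]. *)
Lemma sum_term_exact m N : (m <= N)%N ->
  \sum_(k < N.+1) term q (q ^+ (2 * m + 1) + q ^- (2 * m + 1)) k
  = (- q) ^- m * qint q (2 * m + 1).
Proof.
have rho_exp l : rho (q ^+ l + q ^- l) (q ^+ l) = 0.
  by rewrite rhoE ?expf_neq0 // divff ?expf_neq0 // subrr mulr0.
(* The induction goes from [m] to [m + 2], so [M = 1] (one term) and [M = 3] (two terms) are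
   computed directly. *)
elim/ltn_ind: m N => -[|[|m]] IH N le_mN.
- rewrite (sum_term_rho0 le_mN) // big_ord_recl big_ord0 /term big_ord0.
  by rewrite expr0 invr1 mulr1 addr0.
- rewrite (sum_term_rho0 le_mN) // big_ord_recr big_ord1 /=.
  rewrite /term big_ord0 big_ord1 !qintE // /tfac !rhoE ?expf_neq0 //.
  rewrite expr0 expr1 !muln0 !muln1 !add0n !expr1 -[(6 + 1)%N]/7%N.
  rewrite -[(2 + 1)%N]/3%N.
  have h4 : 1 - q ^+ 4 != 0 by rewrite subr_eq0 eq_sym qn1.
  have h7 : 1 - q ^+ 3 * q ^+ 4 != 0 by rewrite -exprD subr_eq0 eq_sym qn1.
  by field; rewrite oppr_eq0 q0 q1 h4 h7.
have le_m : (m <= N)%N by lia.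
have := IH m (ltnW (ltnSn _)) N le_m.
set y := q ^+ (2 * m + 1) => IHm.
have y0 : y != 0 by rewrite expf_neq0.
have q'1 l : (0 < l)%N -> 1 - q ^+ l != 0 by move=> l0; rewrite subr_eq0 eq_sym qn1.
have y1 : 1 - y != 0 by apply: q'1; lia.
have E : q ^+ (2 * m.+2 + 1) = y * q ^+ 4.
  by rewrite -exprD; congr (_ ^+ _); lia.
have : \sum_(k < N.+1) (q ^+ 2 * (1 - y) * term q (y * q ^+ 4 + (y * q ^+ 4)^-1) k
                - (1 - y * q ^+ 4) * term q (y + y^-1) k) = 0.
  rewrite sum_term_wz //; first 1 last.
  - by rewrite -exprSr q'1.
  - by rewrite -exprD q'1 // addn3.
  - by move=> k; rewrite q'1 // addn4.
  - by move=> k; rewrite -exprD q'1 //; lia.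
  - by move=> k; apply: sub_exp_neq0; lia.
  (* Since [y q^3 = q^(2(m+2))], the factor of index [m + 2] in [wz_prod] is zero; it is present
     because [m + 2 <= N]. *)
  have le_m2 : (m.+2 < N.+1)%N by lia.
  rewrite /wz_prod (bigD1 (Ordinal le_m2)) //=.
  rewrite -exprD (_ : 2 * m + 1 + 3 = 2 * m.+2)%N; last by lia.
  by rewrite subrr !mul0r mulr0 !mul0r.
rewrite sumrB -!mulr_sumr IHm E => /eqP; rewrite subr_eq0 => /eqP eqS.
have y2 : q ^+ 2 * (1 - y) != 0 by rewrite mulf_neq0 ?expf_neq0.
apply: (mulfI y2); rewrite eqS !qintE // E -/y.
have -> : (- q) ^+ m.+2 = (- q) ^+ m * q ^+ 2 by rewrite -addn2 exprD sqrrN.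
have : (- q) ^+ m != 0 by rewrite expf_neq0 ?oppr_eq0.
move: ((- q) ^+ m) => w w0.
by field; rewrite q0 q1 w0.
Qed.

End Exact.

(** * Places and interpolation *)

(* A residue map presented as a functional relation: [res P x w] says that [x]
   is integral at [P] with residue [w], and [unif P] is a uniformizer. *)
Record place (K F : fieldType) := Place {
  res :> K -> F -> Prop;
  unif : K;
  res1 : res 1 1;
  resB : forall x y v w, res x v -> res y w -> res (x - y) (v - w);
  resM : forall x y v w, res x v -> res y w -> res (x * y) (v * w);
  resV : forall x v, v != 0 -> res x v -> res x^-1 v^-1;
  res_inj : forall x v w, res x v -> res x w -> v = w;
  unif_neq0 : unif != 0;
  res_unif : res unif 0;
  res0_unif : forall x, res x 0 -> exists y w, res y w /\ x = unif * y
}.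

Definition local (K F : fieldType) (P : place K F) (x : K) : Prop :=
  exists w, res P x w.

Definition local_unit (K F : fieldType) (P : place K F) (x : K) : Prop :=
  exists2 w, w != 0 & res P x w.

(** The valuation of [x] at [P] is at least [e]. *)
Definition vge (K F : fieldType) (P : place K F) (e : nat) (x : K) : Prop :=
  exists2 y, local P y & x = unif P ^+ e * y.

Section Place.

Variables (K F : fieldType) (P : place K F).
Implicit Types (x y : K) (v w : F).

Lemma res0 : res P 0 0.
Proof. by have := resB (res1 P) (res1 P); rewrite !subrr. Qed.

Lemma resN x v : res P x v -> res P (- x) (- v).
Proof. by move=> h; rewrite -[- x]sub0r -[- v]sub0r; apply: resB h; apply: res0. Qed.

Lemma resD x y v w : res P x v -> res P y w -> res P (x + y) (v + w).
Proof. by move=> h /resN h'; rewrite -[y]opprK -[w]opprK; apply: resB. Qed.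

Lemma res_div x y v w : w != 0 -> res P x v -> res P y w -> res P (x / y) (v / w).
Proof. by move=> w0 h h'; apply: resM => //; apply: resV. Qed.

Lemma resXn x v n : res P x v -> res P (x ^+ n) (v ^+ n).
Proof.
by move=> h; elim: n => [|n IH]; [apply: res1 | rewrite !exprS; apply: resM].
Qed.

Lemma res_sum n (f : nat -> K) (g : nat -> F) :
  (forall i, (i < n)%N -> res P (f i) (g i)) ->
  res P (\sum_(i < n) f i) (\sum_(i < n) g i).
Proof.
elim: n => [_|n IH h]; first by rewrite !big_ord0; apply: res0.
by rewrite !big_ord_recr /=; apply: resD; [apply: IH => i /ltnW | ]; apply: h.
Qed.

Lemma res_prod n (f : nat -> K) (g : nat -> F) :
  (forall i, (i < n)%N -> res P (f i) (g i)) ->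
  res P (\prod_(i < n) f i) (\prod_(i < n) g i).
Proof.
elim: n => [_|n IH h]; first by rewrite !big_ord0; apply: res1.
by rewrite !big_ord_recr /=; apply: resM; [apply: IH => i /ltnW | ]; apply: h.
Qed.

Lemma res_nat n : res P n%:R n%:R.
Proof.
by elim: n => [|n IH]; [apply: res0 | rewrite -!natr1; apply: resD => //; apply: res1].
Qed.

Lemma res_neq0 x w : w != 0 -> res P x w -> x != 0.
Proof.
move=> w0 h; apply: contra_neq w0 => x0.
by apply: res_inj h _; rewrite x0; apply: res0.
Qed.

Lemma localM x y : local P x -> local P y -> local P (x * y).
Proof. by move=> [v h] [w h']; exists (v * w); apply: resM. Qed.

Lemma localB x y : local P x -> local P y -> local P (x - y).
Proof. by move=> [v h] [w h']; exists (v - w); apply: resB. Qed.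

Lemma localXn x n : local P x -> local P (x ^+ n).
Proof. by move=> [w h]; exists (w ^+ n); apply: resXn. Qed.

Lemma local_sum n (f : nat -> K) :
  (forall i, (i < n)%N -> local P (f i)) -> local P (\sum_(i < n) f i).
Proof.
elim: n => [_|n IH h]; first by rewrite big_ord0; exists 0; apply: res0.
rewrite big_ord_recr /=; have [i /ltnW|v hv] := IH; first exact: h.
by have [w hw] := h n (ltnSn n); exists (v + w); apply: resD.
Qed.

Lemma local_prod n (f : nat -> K) :
  (forall i, (i < n)%N -> local P (f i)) -> local P (\prod_(i < n) f i).
Proof.
elim: n => [_|n IH h]; first by rewrite big_ord0; exists 1; apply: res1.
by rewrite big_ord_recr /=; apply: localM; [apply: IH => i /ltnW | ]; apply: h.
Qed.

Lemma local_unit_local x : local_unit P x -> local P x.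
Proof. by case=> w _; exists w. Qed.

Lemma local_unit_neq0 x : local_unit P x -> x != 0.
Proof. by case=> w; apply: res_neq0. Qed.

Lemma local_unit1 : local_unit P 1.
Proof. by exists 1; [apply: oner_neq0 | apply: res1]. Qed.

Lemma local_unitM x y : local_unit P x -> local_unit P y -> local_unit P (x * y).
Proof.
by move=> [v v0 h] [w w0 h']; exists (v * w); [apply: mulf_neq0 | apply: resM].
Qed.

Lemma local_unitV x : local_unit P x -> local_unit P x^-1.
Proof. by move=> [v v0 h]; exists v^-1; [rewrite invr_eq0 | apply: resV]. Qed.

Lemma local_unitXn x n : local_unit P x -> local_unit P (x ^+ n).
Proof.
move=> h; elim: n => [|n IH]; first exact: local_unit1.
by rewrite exprS; apply: local_unitM.
Qed.

Lemma local_unit_prod (I : finType) (p : pred I) (f : I -> K) :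
  (forall i, p i -> local_unit P (f i)) -> local_unit P (\prod_(i | p i) f i).
Proof.
move=> h; elim/big_rec: _ => [|i x /h hi hx]; first exact: local_unit1.
exact: local_unitM.
Qed.

Lemma local_div_unit x y : local P x -> local_unit P y -> local P (x / y).
Proof. by move=> h /local_unitV /local_unit_local; apply: localM. Qed.

Lemma vge0P x : vge P 0 x <-> local P x.
Proof. by split=> [[y h ->]|h]; [rewrite mul1r | exists x; rewrite ?mul1r]. Qed.

Lemma vge1P x : vge P 1 x <-> res P x 0.
Proof.
split=> [[y [w h] ->]|/res0_unif[y [w [h ->]]]].
  by rewrite expr1 -(mul0r w); apply: resM => //; apply: res_unif.
by exists y; [exists w | rewrite expr1].
Qed.

Lemma vgeB e x y : vge P e x -> vge P e y -> vge P e (x - y).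
Proof.
by move=> [x' h ->] [y' h' ->]; exists (x' - y'); [apply: localB | rewrite mulrBr].
Qed.

Lemma vgeM e f x y : vge P e x -> vge P f y -> vge P (e + f) (x * y).
Proof.
move=> [x' h ->] [y' h' ->]; exists (x' * y'); first exact: localM.
by rewrite exprD mulrACA.
Qed.

Lemma vgeMl e x y : local P x -> vge P e y -> vge P e (x * y).
Proof. by move=> /vge0P; apply: vgeM. Qed.

Lemma vge_div e f x u : vge P (e + f) x -> local_unit P u ->
  vge P e (x / (unif P ^+ f * u)).
Proof.
move=> [y h ->] hu; exists (y / u); first exact: local_div_unit.
have := local_unit_neq0 hu => u0; have := expf_neq0 f (unif_neq0 P).
by rewrite exprD; move: (unif P ^+ f) (unif P ^+ e) => a b a0; field; rewrite a0 u0.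
Qed.

(** Newton interpolation on residues: in [p(u) = p1(u) (u - x 0) + p(x 0)] the quotient [p1] has
    residue 0 at the remaining nodes, because node differences are units. Only values enter, so the
    coefficients of [p] may have poles at [P]. *)
Lemma res0_interp s (p : {poly K}) (x : nat -> K) :
  (size p <= s)%N ->
  (forall i, (i < s)%N -> local P (x i)) ->
  (forall i j, (i < j < s)%N -> local_unit P (x j - x i)) ->
  (forall i, (i < s)%N -> res P p.[x i] 0) ->
  forall y, local P y -> res P p.[y] 0.
Proof.
elim: s p x => [|s IH] p x sz lx ux px y ly.
  by move: sz; rewrite leqn0 size_poly_eq0 => /eqP ->; rewrite horner0; apply: res0.
have /factor_theorem[p1 p1E] : root (p - p.[x 0]%:P) (x 0).
  by rewrite rootE !hornerE subrr.
have pE u : p.[u] = p1.[u] * (u - x 0) + p.[x 0].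
  by have := congr1 (fun r => r.[u]) p1E; rewrite /= !hornerE => /eqP;
     rewrite subr_eq => /eqP.
have p1r u : local P u -> res P p1.[u] 0 -> res P p.[u] 0.
  move=> [w hu] h; rewrite pE -(addr0 (0 : F)); apply: resD; last exact: px.
  have [v hx] := lx 0 isT.
  by rewrite -(mul0r (w - v)); apply: resM => //; apply: resB.
apply: p1r => //; apply: (IH _ (fun i => x i.+1)) => // [|i hi|i j hij|i hi].
- have [->|p1n0] := eqVneq p1 0; first by rewrite size_poly0.
  have : (size (p1 * ('X - (x 0)%:P))%R <= s.+1)%N.
    rewrite -p1E (leq_trans (size_polyD _ _)) // geq_max sz size_polyN size_polyC.
    by case: eqP.
  by rewrite size_Mmonic ?monicXsubC // size_XsubC addn2.
- exact: lx.
- exact: ux.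
have [w w0 hw] := ux 0 i.+1 hi.
have -> : p1.[x i.+1] = (p.[x i.+1] - p.[x 0]) / (x i.+1 - x 0).
  by rewrite pE addrK mulfK // (res_neq0 w0 hw).
rewrite -(mul0r w^-1) -{1}(subrr 0); apply: res_div => //.
by apply: resB; apply: px.
Qed.

End Place.

(** * The congruence modulo the cube of a cyclotomic polynomial *)

Section ClearDenominators.

Variables (F : fieldType) (q : F).

Definition rhop (Q : F) : {poly F} := (1 + Q ^+ 2)%:P - Q *: 'X.

Lemma horner_rhop Q b : (rhop Q).[b] = rho b Q.
Proof. by rewrite /rhop !hornerE mulrC. Qed.

Lemma size_rhop Q : (size (rhop Q) <= 2)%N.
Proof.
rewrite (leq_trans (size_polyD _ _)) // geq_max size_polyN.
rewrite (leq_trans (size_polyC_leq1 _)) //=.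
by rewrite (leq_trans (size_scale_leq _ _)) // size_polyX.
Qed.

Lemma size_mul_rhop (p : {poly F}) (Q : F) n :
  (size p <= n)%N -> (size (p * rhop Q)%R <= n.+1)%N.
Proof.
move=> sp; rewrite (leq_trans (size_polyMleq _ _)) //.
by have := size_rhop Q; lia.
Qed.

Definition den b N := \prod_(i < N) rho b (q ^+ (4 * i + 4)).

(** The degree bound is what interpolation needs: going from [N] to [N + 1] multiplies by one linear
    factor in [b] and adds a multiple of a product of [N + 1] linear factors. *)
Lemma clear_den N : exists2 p : {poly F}, (size p <= N.+1)%N &
  forall b, (forall i, (i < N)%N -> rho b (q ^+ (4 * i + 4)) != 0) ->
  p.[b] = den b N * \sum_(k < N.+1) term q b k.
Proof.
pose num k : {poly F} := \prod_(i < k) rhop (q ^+ (2 * i + 1)).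
have size_num k : (size (num k) <= k.+1)%N.
  elim: k => [|k IH]; first by rewrite /num big_ord0 size_poly1.
  by rewrite /num big_ord_recr /=; apply: size_mul_rhop.
pose c k := q ^+ (k ^ 2) * qint q (6 * k + 1)
  * \prod_(i < k) ((1 - q ^+ (4 * i + 2)) / (1 - q ^+ (4 * i + 4))).
elim: N => [|N [p sp hp]].
  exists 1%:P; first by rewrite size_poly1.
  move=> b _; rewrite /den big_ord0 big_ord1 /term big_ord0 hornerC.
  by rewrite muln0 /qint big_ord1 !mulr1.
exists (p * rhop (q ^+ (4 * N + 4)) + c N.+1 *: num N.+1).
  rewrite (leq_trans (size_polyD _ _)) // geq_max size_mul_rhop //.
  exact: leq_trans (size_scale_leq _ _) (size_num _).
move=> b b0; rewrite hornerD hornerM hornerZ horner_rhop hp; last first.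
  by move=> i /ltnW; apply: b0.
have -> : \sum_(k < N.+2) term q b k = \sum_(k < N.+1) term q b k + term q b N.+1.
  by rewrite big_ord_recr.
have denS : den b N.+1 = den b N * rho b (q ^+ (4 * N + 4)).
  by rewrite /den big_ord_recr.
rewrite [RHS]mulrDr; congr (_ + _); first by rewrite denS mulrAC.
rewrite /term /num horner_prod /c mulrCA -!mulrA; congr (_ * (_ * _)).
rewrite /den -!big_split /=; apply: eq_bigr => i _.
rewrite horner_rhop /tfac invfM.
move: (b0 i (ltn_ord i)); move: (rho b (q ^+ (4 * i + 4))) => r r0.
move: (rho b _) (1 - q ^+ (4 * i + 2)) (1 - q ^+ (4 * i + 4))^-1 => u v t.
by field; rewrite r0.
Qed.

End ClearDenominators.

Section RootOfUnity.

Variables (z : algC) (d : nat).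
Hypothesis primz : d.-primitive_root z.

Lemma subr_prim_neq0 i : ~~ (d %| i)%N -> 1 - z ^+ i != 0.
Proof. by rewrite subr_eq0 eq_sym -(prim_order_dvd primz). Qed.

Lemma prim_neq0 : z != 0.
Proof.
apply/eqP => z0; have := prim_expr_order primz; rewrite z0 expr0n.
have := prim_order_gt0 primz; case: d => // ? _ /eqP.
by rewrite eq_sym oner_eq0.
Qed.

(* [|w + w^-1| <= 2] on the unit circle. *)
Lemma rho_nat_neq0 (beta i : nat) : (2 < beta)%N -> rho (beta%:R : algC) (z ^+ i) != 0.
Proof.
move=> beta_gt2; apply/eqP => rho0.
have w0 : z ^+ i != 0 by rewrite expf_neq0 // prim_neq0.
have nw : `|z ^+ i| = 1.
  apply/eqP; rewrite -(pexpr_eq1 (prim_order_gt0 primz)) // -normrX -exprM.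
  by rewrite mulnC exprM (prim_expr_order primz) expr1n normr1.
have : beta%:R = (z ^+ i)^-1 + z ^+ i.
  apply: (mulIf w0); apply/esym/eqP; rewrite -subr_eq0; apply/eqP.
  by rewrite -[RHS]rho0 /rho; field.
move/(congr1 Num.norm); rewrite normr_nat => bE.
have := ler_normD (z ^+ i)^-1 (z ^+ i).
by rewrite -bE normfV nw invr1 -[1 + 1]/(2%:R) ler_nat leqNgt beta_gt2.
Qed.

End RootOfUnity.

Section Cfac.

Variables (F : fieldType) (q : F).

Lemma cfacE m : cfac q (2 * m + 1) = (- q) ^- m * qint q (2 * m + 1).
Proof. by rewrite /cfac addnK mulKn. Qed.

(** For odd [d] and [m], [(dm-1)/2 = (d-1)/2 + d (m-1)/2] and [(-q)^d = -q^d]. This cocycle relation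
    lets exact values and congruences over [q] and [q^d] be composed. *)
Lemma cfacM d m : odd d -> odd m -> 1 - q != 0 -> 1 - q ^+ d != 0 ->
  cfac q (d * m) = cfac q d * cfac (q ^+ d) m.
Proof.
move=> od om q1 qd1; rewrite /cfac !qintE // mulrACA -invfM; congr (_^-1 * _).
  have [e dE] : exists e, d = (2 * e + 1)%N.
    by exists d./2; rewrite -[LHS]odd_double_half od; lia.
  have [f mE] : exists f, m = (2 * f + 1)%N.
    by exists m./2; rewrite -[LHS]odd_double_half om; lia.
  have -> : ((d * m - 1) %/ 2 = (d - 1) %/ 2 + d * ((m - 1) %/ 2))%N.
    rewrite dE mE !addnK !mulKn //.
    rewrite (_ : _ - 1 = 2 * (e + (2 * e + 1) * f))%N ?mulKn //.
    by nia.
  rewrite exprD exprM; congr (_ * _ ^+ _).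
  by rewrite exprNn -signr_odd od expr1 mulN1r.
by rewrite exprM mulrACA mulrC; field; rewrite q1 qd1.
Qed.

End Cfac.

(** * Sums over a base with residue 1 *)

Section ResidueOne.

Variables (K : fieldType) (P : place K algC) (q : K).
Hypothesis resq : res P q 1.
Hypothesis simple : forall j, (0 < j)%N ->
  exists2 y, local_unit P y & 1 - q ^+ j = unif P * y.

Lemma local_qint q' m : local P q' -> local P (qint q' m).
Proof.
by move=> h; apply: (local_sum (f := fun i => q' ^+ i)) => i _; apply: localXn.
Qed.

Lemma local_sum_term b m : (forall i, local P (tfac q b i)) ->
  local P (\sum_(k < m) term q b k).
Proof.
have lq : local P q by exists 1.
move=> h; apply: (local_sum (f := term q b)) => k _.
apply: localM; first by apply: localM; [apply: localXn | apply: local_qint].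
exact: (local_prod (f := tfac q b)).
Qed.

(** The [rho] factors reduce to [2 - beta], which is nonzero; the simple zeros of [1 - q^(4i+2)] and
    [1 - q^(4i+4)] cancel. *)
Lemma local_sum_term_nat beta m : (2 < beta)%N ->
  local P (\sum_(k < m) term q beta%:R k).
Proof.
move=> hb; apply: local_sum_term => i.
have hr l : local_unit P (rho beta%:R (q ^+ l)).
  exists (rho beta%:R (1 ^+ l)).
    by rewrite /rho !expr1n mulr1 subr_eq0 -[1 + 1]/(2%:R) eqr_nat; lia.
  apply: resB; last by apply: resM; [apply: res_nat | apply: resXn].
  by apply: resD; [apply: res1 | apply/resXn/resXn].
rewrite /tfac; have [|y uy ->] := @simple (4 * i + 2); first by lia.
have [|y' uy' ->] := @simple (4 * i + 4); first by lia.
rewrite -mulf_div; apply: localM.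
  by apply: local_div_unit => //; apply: local_unit_local.
rewrite -mulf_div divff ?unif_neq0 // mul1r.
by apply: local_div_unit => //; apply: local_unit_local.
Qed.

Lemma rho2 (F : fieldType) (Q : F) : rho 2%:R Q = (1 - Q) ^+ 2.
Proof. by rewrite /rho; ring. Qed.

(** At [b = 2] the numerator and the denominator of each [tfac] both have valuation exactly 3. *)
Lemma local_sum_term2 m : local P (\sum_(k < m) term q 2%:R k).
Proof.
apply: local_sum_term => i; rewrite /tfac !rho2.
have [|x ux ->] := @simple (2 * i + 1); first by lia.
have [|y uy ->] := @simple (4 * i + 2); first by lia.
have [|w uw ->] := @simple (4 * i + 4); first by lia.
have -> : (unif P * x) ^+ 2 * (unif P * y) / ((unif P * w) ^+ 2 * (unif P * w))
  = x ^+ 2 * y / w ^+ 3.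
  by field; rewrite unif_neq0 (local_unit_neq0 uw).
apply: local_div_unit; last exact: local_unitXn.
by apply/local_unit_local/local_unitM => //; apply: local_unitXn.
Qed.

Lemma den2_unif n : exists2 u, local_unit P u & den q 2%:R n = unif P ^+ (2 * n) * u.
Proof.
elim: n => [|n [u hu IH]].
  by exists 1; [apply: local_unit1 | rewrite /den big_ord0 mulr1].
have [|y uy yE] := @simple (4 * n + 4); first by lia.
exists (u * y ^+ 2); first by apply: local_unitM => //; apply: local_unitXn.
rewrite /den big_ord_recr /= -/(den q _ n) IH rho2 yE mulnS exprD.
by rewrite exprMn; move: (unif P ^+ (2 * n)) => v; ring.
Qed.

End ResidueOne.

(** * The congruence at a place where [q] reduces to a primitive [d]-th root of unity *)

Section Key.

Variables (K : fieldType) (P : place K algC) (q : K) (z : algC) (d : nat).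
Hypotheses (primz : d.-primitive_root z) (resq : res P q z).
Hypotheses (dodd : odd d) (dgt1 : (1 < d)%N).
Hypothesis simple : forall j, (0 < j)%N ->
  exists2 y, local_unit P y & 1 - q ^+ (d * j) = unif P * y.

Let h := d./2.
Let dE : d = (2 * h + 1)%N.
Proof. by rewrite -[LHS]odd_double_half dodd /h; lia. Qed.

Let z0 : z != 0 := prim_neq0 primz.
Let q0 : q != 0 := res_neq0 z0 resq.

Let z1 : 1 - z != 0.
Proof. by rewrite -(expr1 z) (subr_prim_neq0 primz) // dvdn1; lia. Qed.

Lemma res_sub_exp i : res P (1 - q ^+ i) (1 - z ^+ i).
Proof. by apply: resB; [apply: res1 | apply: resXn]. Qed.

Lemma unit_sub_exp i : ~~ (d %| i)%N -> local_unit P (1 - q ^+ i).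
Proof.
move=> ndi; exists (1 - z ^+ i); last exact: res_sub_exp.
exact: subr_prim_neq0 primz _ _.
Qed.

Lemma exp_neq1 i : (0 < i)%N -> q ^+ i != 1.
Proof.
move=> i0; rewrite eq_sym -subr_eq0.
have [/dvdnP[j jE]|] := boolP (d %| i)%N; last first.
  by move/unit_sub_exp/local_unit_neq0.
have [|y /local_unit_neq0 y0] := @simple j.
  by move: i0; rewrite jE muln_gt0 => /andP[].
by rewrite mulnC -jE => ->; rewrite mulf_neq0 // unif_neq0.
Qed.

Let q1 : 1 - q != 0.
Proof. by rewrite subr_eq0 eq_sym -(expr1 q) exp_neq1. Qed.

Lemma res_rho b beta Q w : res P b beta -> res P Q w -> res P (rho b Q) (rho beta w).
Proof.
move=> hb hQ; rewrite /rho; apply: resB; last exact: resM.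
by apply: resD; [apply: res1 | apply: resXn].
Qed.

Lemma res_qint m : res P (qint q m) (qint z m).
Proof.
apply: (res_sum (f := fun i => q ^+ i) (g := fun i => z ^+ i)) => i _.
exact: resXn.
Qed.

(** Since [z^d = 1], the reduced factors are periodic in the index; the side conditions keep the
    reduced denominator nonzero. *)
Lemma res_tfac b beta i j : res P b beta -> rho beta (z ^+ (4 * j + 4)) != 0 ->
  ~~ (d %| 4 * j + 4)%N -> i = j %[mod d] -> res P (tfac q b i) (tfac z beta j).
Proof.
move=> hb rho0 dj eqij.
have zE m c : z ^+ (m * i + c) = z ^+ (m * j + c).
  rewrite -(prim_expr_mod primz (m * i + c)) -(prim_expr_mod primz (m * j + c)).
  by congr (_ ^+ _); rewrite -modnDml -modnMmr eqij modnMmr modnDml.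
rewrite /tfac; apply: res_div.
- by rewrite mulf_neq0 // (subr_prim_neq0 primz).
- apply: resM; first by apply: res_rho => //; rewrite -zE; apply: resXn.
  by rewrite -zE; apply: res_sub_exp.
- apply: resM; first by apply: res_rho => //; rewrite -zE; apply: resXn.
  by rewrite -zE; apply: res_sub_exp.
Qed.

Let node i : K := q ^+ (2 * i + 1) + q ^- (2 * i + 1).
Let nodez i : algC := z ^+ (2 * i + 1) + z ^- (2 * i + 1).

Let res_node i : res P (node i) (nodez i).
Proof.
apply: resD; first exact: resXn.
by apply: resV; [rewrite expf_neq0 | apply: resXn].
Qed.

Lemma sub_node (F : fieldType) (x : F) i j : x != 0 -> (i <= j)%N ->
  x ^+ (2 * j + 1) + x ^- (2 * j + 1) - (x ^+ (2 * i + 1) + x ^- (2 * i + 1))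
  = x ^- (2 * j + 1) * (1 - x ^+ (2 * (j - i))) * (1 - x ^+ (2 * (i + j + 1))).
Proof.
move=> x0 ij; have -> : (2 * j + 1 = (2 * i + 1) + 2 * (j - i))%N by lia.
have -> : (2 * (i + j + 1) = (2 * i + 1) + (2 * i + 1) + 2 * (j - i))%N by lia.
move: (2 * i + 1)%N (2 * (j - i))%N => a b.
have := expf_neq0 a x0; have := expf_neq0 b x0; rewrite !exprD.
by move: (x ^+ a) (x ^+ b) => u v v0 u0; field; rewrite u0 v0.
Qed.

Lemma den_node_neq0 m N : den q (node m) N != 0.
Proof.
apply/prodf_neq0 => i _; rewrite /node rhoE ?expf_neq0 // -exprD mulf_neq0 //.
  by rewrite subr_eq0 eq_sym exp_neq1 //; lia.
rewrite subr_eq0 eq_sym; apply/eqP => /(canRL (divfK (expf_neq0 (2 * m + 1) q0))).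
rewrite mul1r => /eqP; apply/negP; rewrite -subr_eq0.
by apply: (sub_exp_neq0 q0 exp_neq1); lia.
Qed.

(* Multiplication by 4 permutes the nonzero residues modulo [d], so the factor
   of [den] at [4 i + 4 = +- (2 m + 1)] vanishes. *)
Lemma res_den_node m : (m < h)%N -> res P (den q (node m) h) 0.
Proof.
move=> lt_mh.
have -> : 0 = \prod_(i < h) rho (nodez m) (z ^+ (4 * i + 4)) :> algC.
  suff [i lt_ih [s1|s1]] : exists2 i, (i < h)%N &
      z ^+ (4 * i + 4) * z ^+ (2 * m + 1) = 1 \/ z ^+ (4 * i + 4) = z ^+ (2 * m + 1).
  - rewrite (bigD1 (Ordinal lt_ih)) //= /nodez rhoE ?expf_neq0 //.
    by rewrite [z ^+ (2 * m + 1) * _]mulrC s1 subrr !mul0r.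
  - rewrite (bigD1 (Ordinal lt_ih)) //= /nodez rhoE ?expf_neq0 //.
    by rewrite s1 divff ?expf_neq0 // subrr mulr0 mul0r.
  (* To solve [4c = -(2m+1)] modulo [d], take for [4c] a Chinese remainder of 0 modulo 4 and
     [d - (2m+1)] modulo [d]. *)
  have [c /dvdnP[t ct]] : exists c, (d %| 4 * c + (2 * m + 1))%N.
    have co : coprime 4 d by rewrite (@coprime_pexpl 2 2) // coprime2n.
    have := chinese_modr co 0 (d - (2 * m + 1)).
    have := chinese_modl co 0 (d - (2 * m + 1)).
    set c := chinese _ _ _ _ => /eqP; rewrite mod0n -/(4 %| c)%N => /dvdnP[t ->] e.
    exists t; rewrite /dvdn -modnDml mulnC e modnDml subnK ?modnn //; lia.
  have c0 : (c %% d != 0)%N.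
    apply/negP => /eqP c0; have : (d %| 2 * m + 1)%N.
      have dc : (d %| 4 * c)%N by rewrite dvdn_mull // /dvdn c0.
      by rewrite -(dvdn_addr _ dc) ct dvdn_mull.
    by move/dvdn_leq; lia.
  have zc : z ^+ (4 * (c %% d)) * z ^+ (2 * m + 1) = 1.
    rewrite -exprD; apply/eqP; rewrite -(prim_order_dvd primz).
    by rewrite /dvdn -modnDml modnMmr modnDml ct modnMl.
  have ltcd : (c %% d < d)%N by rewrite ltn_mod; lia.
  (* One of [c mod d] and [d - (c mod d)] lies in [1..h]; predecessors appear because factor [i] of
     [den] carries [4 (i + 1)]. *)
  have [le_ch|lt_hc] := leqP (c %% d) h.
    exists (c %% d).-1; first by lia.
    by left; rewrite (_ : 4 * (c %% d).-1 + 4 = 4 * (c %% d))%N //; lia.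
  exists (d - c %% d).-1; first by lia.
  right; have zc0 : z ^+ (4 * (c %% d)) != 0 by rewrite expf_neq0.
  apply: (mulfI zc0); rewrite zc -exprD; apply/eqP; rewrite -(prim_order_dvd primz).
  by apply/dvdnP; exists 4%N; lia.
apply: (res_prod (f := fun i => rho _ (q ^+ (4 * i + 4)))
                 (g := fun i => rho _ (z ^+ (4 * i + 4)))) => i _.
by apply: res_rho; [apply: res_node | apply: resXn].
Qed.

Lemma unit_rho_nat beta i : (2 < beta)%N -> local_unit P (rho beta%:R (q ^+ i)).
Proof.
move=> hb; exists (rho beta%:R (z ^+ i)); first exact: rho_nat_neq0 primz _ _ hb.
by apply: res_rho; [apply: res_nat | apply: resXn].
Qed.

(** The cleared numerator has degree at most [h] in [b] and residue 0 at the [h + 1] nodes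
    [M = 1, 3, .., d]: at the first [h] because [den] reduces to 0, at the last because [[d]] does.
    So it has residue 0 at [beta], where [den] is a unit. *)
Lemma res_half_sum beta : (2 < beta)%N -> res P (\sum_(k < h.+1) term q beta%:R k) 0.
Proof.
move=> hb; have [p sp hp] := clear_den q h.
have pb : res P p.[beta%:R] 0.
  apply: (res0_interp sp (x := node)); last by exists beta%:R; apply: res_nat.
  - by move=> i _; exists (nodez i); apply: res_node.
  - move=> i j /andP[ij jh].
    exists (nodez j - nodez i); last by apply: resB; apply: res_node.
    rewrite /nodez sub_node ?(ltnW ij) // !mulf_neq0 ?invr_eq0 ?expf_neq0 //.
      apply: (subr_prim_neq0 primz); rewrite Gauss_dvdr ?coprimen2 //.
      by apply/negP => /dvdn_leq; lia.
    apply: (subr_prim_neq0 primz); rewrite Gauss_dvdr ?coprimen2 //.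
    by apply/negP => /dvdn_leq; lia.
  - move=> i ih; rewrite hp; last first.
      by move=> l lh; have /prodf_neq0/(_ (Ordinal lh)) := den_node_neq0 i h; apply.
    rewrite /node (sum_term_exact q0 exp_neq1) // -/(node i).
    have hc : res P ((- q) ^- i * qint q (2 * i + 1)) ((- z) ^- i * qint z (2 * i + 1)).
      apply: resM; last exact: res_qint.
      by apply: resV; [rewrite expf_neq0 ?oppr_eq0 | apply: resXn; apply: resN].
    have [lt_ih|le_hi] := ltnP i h.
      rewrite -(mul0r ((- z) ^- i * qint z (2 * i + 1))).
      by apply: resM => //; apply: res_den_node.
    have ei : i = h by lia.
    rewrite ei -dE in hc *.
    rewrite (qintE _ z1) (prim_expr_order primz) subrr mul0r mulr0 in hc.
    rewrite -(mulr0 (\prod_(l < h) rho (nodez h) (z ^+ (4 * l + 4)))).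
    apply: resM => //.
    apply: (res_prod (f := fun i => rho _ (q ^+ (4 * i + 4)))
                 (g := fun i => rho _ (z ^+ (4 * i + 4)))) => l _.
    by apply: res_rho; [apply: res_node | apply: resXn].
have ud : local_unit P (den q beta%:R h).
  by apply: local_unit_prod => i _; apply: unit_rho_nat.
have := hp beta%:R => /(_ (fun i _ => local_unit_neq0 (unit_rho_nat _ hb))) E.
have [u u0 hu] := ud.
have -> : \sum_(k < h.+1) term q beta%:R k = p.[beta%:R] / den q beta%:R h.
  by rewrite E mulrC mulKf // (local_unit_neq0 ud).
by rewrite -(mul0r u^-1); apply: res_div.
Qed.

Lemma dvd4S i : (d %| 4 * i + 4)%N = (d %| i.+1)%N.
Proof.
rewrite (_ : 4 * i + 4 = 4 * i.+1)%N; last by lia.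
by rewrite Gauss_dvdr // coprime_sym (@coprime_pexpl 2 2) // coprime2n.
Qed.

Lemma res_prod_tfac beta l k : (2 < beta)%N -> (k < d)%N ->
  res P (\prod_(i < k) tfac q beta%:R (d * l + i)) (\prod_(i < k) tfac z beta%:R i).
Proof.
move=> hb kd; apply: (res_prod (f := fun i => tfac q _ (d * l + i))) => i ik.
apply: res_tfac => //; first exact: res_nat.
- exact: rho_nat_neq0 primz _ _ hb.
- by rewrite dvd4S; apply/negP => /dvdn_leq; lia.
- by rewrite mulnC modnMDl.
Qed.

(** For [h' = h] this is [res_half_sum] with uniqueness of residues; later terms contain
    [1 - z^(4h+2) = 1 - z^(2d) = 0]. *)
Lemma sum_term_root beta h' : (2 < beta)%N -> (h <= h' < d)%N ->
  \sum_(k < h'.+1) term z beta%:R k = 0 :> algC.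
Proof.
move=> hb /andP[hh' h'd].
have hd : (h < d)%N by lia.
have half : \sum_(k < h.+1) term z beta%:R k = 0 :> algC.
  refine (res_inj _ (res_half_sum hb)).
  apply: (res_sum (f := term q _)) => k kh; apply: resM.
    by apply: resM; [apply: resXn | apply: res_qint].
  by have := @res_prod_tfac beta 0 k hb; rewrite muln0; apply; lia.
rewrite -[RHS]half -!(big_mkord xpredT) (big_cat_nat (leq0n h.+1)) //= -[RHS]addr0.
congr (_ + _); rewrite big_nat_cond big1 // => k /andP[/andP[hk _] _].
rewrite /term (bigD1 (Ordinal hk)) //= /tfac (_ : 4 * h + 2 = d * 2)%N; last by lia.
by rewrite exprM (prim_expr_order primz) expr1n subrr mulr0 !mul0r mulr0.
Qed.

Lemma prod_blocks (G : comPzRingType) (f : nat -> G) m n :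
  \prod_(i < m + n) f i = (\prod_(i < m) f i) * \prod_(i < n) f (m + i)%N.
Proof. by rewrite big_split_ord. Qed.

(** In each block of [d] indices exactly one numerator factor (offset [h], since [4h + 2 = 2d]) and
    one denominator factor (offset [d - 1]) vanish at [P]; both zeros are simple and cancel. *)
Lemma local_prod_tfac beta l : (2 < beta)%N ->
  local P (\prod_(i < d * l) tfac q beta%:R i).
Proof.
move=> hb; elim: l => [|l IH]; first by rewrite muln0 big_ord0; exists 1; apply: res1.
rewrite mulnSr prod_blocks; apply: localM => //.
rewrite /tfac prodf_div !big_split /= invfM mulrACA.
apply: localM.
  apply: local_div_unit; last by apply: local_unit_prod => i _; apply: unit_rho_nat.
  by apply/local_unit_local/local_unit_prod => i _; apply: unit_rho_nat.
have hd : (h < d)%N by lia.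
have d'd : (d.-1 < d)%N by lia.
rewrite (bigD1 (Ordinal hd)) //= [X in _ / X](bigD1 (Ordinal d'd)) //=.
rewrite (_ : 4 * (d * l + h) + 2 = d * (4 * l + 2))%N; last by nia.
rewrite (_ : 4 * (d * l + d.-1) + 4 = d * (4 * l + 4))%N; last by nia.
have [|y uy ->] := @simple (4 * l + 2); first by lia.
have [|y' uy' ->] := @simple (4 * l + 4); first by lia.
rewrite -(mulrA _ y) -(mulrA _ y') -mulf_div divff ?unif_neq0 // mul1r.
apply: local_div_unit; last first.
  apply: local_unitM => //; apply: local_unit_prod => i /eqP ne_i.
  apply: unit_sub_exp; rewrite dvd4S -addnS dvdn_addr ?dvdn_mulr //.
  apply/negP => /(dvdn_leq (ltn0Sn _)) le_di; apply: ne_i; apply: val_inj => /=.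
  by have := ltn_ord i; lia.
apply: localM; first exact: local_unit_local.
apply/local_unit_local; apply: local_unit_prod => i /eqP ne_i.
apply: unit_sub_exp; apply/negP => dv; apply: ne_i; apply: val_inj => /=.
move: dv; rewrite (_ : 4 * (d * l + i) + 2 = d * (4 * l) + 2 * (2 * i + 1))%N; last by nia.
rewrite dvdn_addr; last exact: dvdn_mulr.
rewrite Gauss_dvdr ?coprimen2 // => /dvdnP[c cE].
have d0 : (0 < d)%N by lia.
have id := ltn_ord i; have : (c < 2)%N by rewrite -(ltn_pmul2r d0) -cE; lia.
by case: c cE => [|[|c]]; lia.
Qed.

(** Factoring out the local product over the first [l] blocks leaves terms that reduce to [term z]
    by periodicity. *)
Lemma res_block_sum beta l h' : (2 < beta)%N -> (h <= h' < d)%N ->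
  res P (\sum_(k < h'.+1) term q beta%:R (d * l + k)) 0.
Proof.
move=> hb hh'; have [w hw] := local_prod_tfac l hb.
have zd : z ^+ d = 1 := prim_expr_order primz.
have -> : \sum_(k < h'.+1) term q beta%:R (d * l + k)
  = (\prod_(i < d * l) tfac q beta%:R i) *
    \sum_(k < h'.+1) (q ^+ ((d * l + k) ^ 2) * qint q (6 * (d * l + k) + 1)
                     * \prod_(i < k) tfac q beta%:R (d * l + i)).
  rewrite mulr_sumr; apply: eq_bigr => k _.
  by rewrite /term (prod_blocks (tfac q _)) mulrCA mulrA.
rewrite -(mulr0 w) -(sum_term_root hb hh'); apply: resM => //.
apply: (res_sum (g := term z _)
  (f := fun k => q ^+ ((d * l + k) ^ 2) * qint q (6 * (d * l + k) + 1)
                 * \prod_(i < k) tfac q beta%:R (d * l + i))) => k kh.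
apply: resM; last by apply: res_prod_tfac => //; lia.
have zE c m e : z ^+ (d * c + m * e) = z ^+ (m * e).
  by rewrite exprD exprM zd expr1n mul1r.
apply: resM.
  have -> : z ^+ (k ^ 2) = z ^+ ((d * l + k) ^ 2).
    by rewrite -!mulnn -(zE (d * l * l + 2 * l * k)%N); congr (_ ^+ _); nia.
  exact: resXn.
have -> : qint z (6 * k + 1) = qint z (6 * (d * l + k) + 1).
  rewrite !qintE //; congr ((1 - _) / _).
  by rewrite -[in LHS](muln1 (6 * k + 1)%N) -(zE (6 * l)%N); congr (_ ^+ _); nia.
exact: res_qint.
Qed.

Lemma res_full_sum beta n h' : (2 < beta)%N -> (h <= h' < d)%N ->
  res P (\sum_(k < (d * n + h').+1) term q beta%:R k) 0.
Proof.
move=> hb; elim: n h' => [|n IH] h' hh'.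
  by have := res_block_sum 0 hb hh'; rewrite muln0.
rewrite (_ : (d * n.+1 + h').+1 = (d * n + d.-1).+1 + h'.+1)%N; last by lia.
rewrite big_split_ord /= -(addr0 (0 : algC)); apply: resD; first by apply: IH; lia.
have -> : (d * n + d.-1).+1 = (d * n.+1)%N by lia.
exact: res_block_sum.
Qed.

(** Indices with [d | i + 1] end the complete blocks; the incomplete block has none. This isolates
    the part of [den q] that is [den (q ^+ d)]. *)
Lemma prod_dvd_succ (f : nat -> K) n m : (m < d)%N ->
  \prod_(i < d * n + m | (d %| i.+1)%N) f i = \prod_(l < n) f (d * l + d.-1)%N.
Proof.
move=> md; rewrite big_mkcond /=.
rewrite (prod_blocks (fun i => if (d %| i.+1)%N then f i else 1)).
rewrite [X in _ * X]big1 ?mulr1 => [|i _]; last first.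
  rewrite -addnS dvdn_addr ?dvdn_mulr //; case: ifP => // /(dvdn_leq (ltn0Sn _)).
  by have := ltn_ord i; lia.
elim: n => [|n IH]; first by rewrite muln0 !big_ord0.
rewrite mulnSr (prod_blocks (fun i => if (d %| i.+1)%N then f i else 1)) IH.
rewrite big_ord_recr /=; congr (_ * _).
have d'd : (d.-1 < d)%N by lia.
rewrite (bigD1 (Ordinal d'd)) //= -addnS prednK; last by lia.
rewrite dvdn_addr ?dvdn_mulr // dvdnn big1 ?mulr1 // => i /eqP ne_i.
rewrite -addnS dvdn_addr ?dvdn_mulr //; case: ifP => // /(dvdn_leq (ltn0Sn _)) le_di.
by case: ne_i; apply: val_inj => /=; have := ltn_ord i; lia.
Qed.

Let resqd : res P (q ^+ d) 1.
Proof. by rewrite -(prim_expr_order primz); apply: resXn. Qed.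

Let simpled j : (0 < j)%N -> exists2 y, local_unit P y & 1 - (q ^+ d) ^+ j = unif P * y.
Proof. by rewrite -exprM; apply: simple. Qed.

Lemma res_cfac m : (d %| m)%N -> res P (cfac q m) 0.
Proof.
move=> dm; rewrite /cfac -(mulr0 ((- z) ^- ((m - 1) %/ 2))); apply: resM.
  by apply: resV; [rewrite expf_neq0 ?oppr_eq0 | apply: resXn; apply: resN].
have /eqP zm : z ^+ m == 1 by rewrite -(prim_order_dvd primz).
by have := res_qint m; rewrite (qintE _ z1) zm subrr mul0r.
Qed.

(** Valuation count at [b = 2]: the numerator [p] of the difference has [n + 1] roots [x j], each
    contributing 2, and the cofactor [r] contributes 1, whereas the denominator has valuation [2n];
    what remains is [2(n+1) + 1 - 2n = 3]. *)
Lemma dwork_congruence n h' : (h <= h' < d)%N ->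
  vge P 3 (\sum_(k < (d * n + h').+1) term q 2%:R k
           - cfac q d * \sum_(k < n.+1) term (q ^+ d) 2%:R k).
Proof.
move=> hh'; set N := (d * n + h')%N; set c := cfac q d.
have [p1 _ p1E] := clear_den q N; have [p2 _ p2E] := clear_den (q ^+ d) n.
pose S1 b := \sum_(k < N.+1) term q b k.
pose S2 b := \sum_(k < n.+1) term (q ^+ d) b k.
rewrite -/(S1 _) -/(S2 _).
(* Since [den q b N = den (q ^+ d) b n * rest b], a single denominator clears both sums. *)
pose rest b := \prod_(i < N | ~~ (d %| i.+1)%N) rho b (q ^+ (4 * i + 4)).
pose restp : {poly K} := \prod_(i < N | ~~ (d %| i.+1)%N) rhop (q ^+ (4 * i + 4)).
have restE b : restp.[b] = rest b.
  by rewrite /restp horner_prod; apply: eq_bigr => i _; rewrite horner_rhop.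
have expE i : q ^+ (4 * (d * i + d.-1) + 4) = (q ^+ d) ^+ (4 * i + 4).
  by rewrite -exprM; congr (_ ^+ _); nia.
have denE b : den q b N = den (q ^+ d) b n * rest b.
  rewrite /den (bigID (fun i : 'I_N => (d %| i.+1)%N)) /= /N.
  rewrite (prod_dvd_succ (fun i => rho b (q ^+ (4 * i + 4)))); last by lia.
  by congr (_ * _); apply: eq_bigr => i _; rewrite expE.
pose p := p1 - c *: (restp * p2).
have pE b : den q b N != 0 -> p.[b] = den q b N * (S1 b - c * S2 b).
  move=> /prodf_neq0 b0; rewrite hornerD hornerN hornerZ hornerM restE p1E; last first.
    by move=> i iN; apply: (b0 (Ordinal iN)).
  rewrite p2E => [|i ilt]; first by rewrite denE -/(S1 b) -/(S2 b); ring.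
  have iN : (d * i + d.-1 < N)%N by rewrite /N; nia.
  by rewrite -expE; apply: (b0 (Ordinal iN)).
(* As [2(dj + h) + 1 = d(2j + 1)], both sums terminate at [x j]: over [q] with [M = d(2j+1)], over
   [q^d] with [M = 2j+1]. Their exact values match by [cfacM]. *)
pose x j := node (d * j + h).
have xE j : x j = (q ^+ d) ^+ (2 * j + 1) + (q ^+ d) ^- (2 * j + 1).
  by rewrite /x /node -exprM (_ : 2 * (d * j + h) + 1 = d * (2 * j + 1))%N //; nia.
have qd1 i : (0 < i)%N -> (q ^+ d) ^+ i != 1.
  by move=> i0; rewrite -exprM exp_neq1 // muln_gt0 i0; lia.
have qd0 : q ^+ d != 0 by rewrite expf_neq0.
have rootx j : (j <= n)%N -> root p (x j).
  move=> jn; rewrite rootE pE ?den_node_neq0 // mulf_eq0 subr_eq0; apply/orP; right.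
  rewrite /S1 /S2 {1}/x /node (sum_term_exact q0 exp_neq1); last by rewrite /N; nia.
  rewrite xE (sum_term_exact qd0 qd1) // -!cfacE.
  rewrite (_ : 2 * (d * j + h) + 1 = d * (2 * j + 1))%N; last by nia.
  rewrite cfacM //; first by rewrite oddD oddM.
  by rewrite subr_eq0 eq_sym exp_neq1 //; lia.
have uniqx : uniq (mkseq x n.+1).
  apply/(uniqP 0) => i j; rewrite !inE !size_mkseq => ilt jlt; rewrite !nth_mkseq //.
  wlog ij : i j ilt jlt / (i <= j)%N.
    by move=> H; case: (leqP i j) => [|/ltnW] ij e; [apply: H | symmetry; apply: H].
  move=> /esym/eqP; rewrite -subr_eq0 !xE sub_node //.
  rewrite !mulf_eq0 invr_eq0 expf_eq0 (negbTE qd0) andbF /= => /orP[] /eqP/eqP.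
    rewrite subr_eq0 eq_sym; case: (posnP (j - i)) => [|ji]; first by lia.
    by rewrite (negbTE (qd1 _ _)) // muln_gt0.
  by rewrite subr_eq0 eq_sym (negbTE (qd1 _ _)) //; lia.
have /dvdpP[r rE] : \prod_(u <- mkseq x n.+1) ('X - u%:P) %| p.
  apply: uniq_roots_dvdp; last by rewrite uniq_rootsE.
  apply/allP => u /mapP[j]; rewrite mem_iota add0n ltnS => /andP[_ jn] ->.
  exact: rootx.
have prE b : p.[b] = r.[b] * \prod_(j < n.+1) (b - x j).
  rewrite rE hornerM /mkseq big_map -[iota 0 n.+1]/(index_iota 0 n.+1) big_mkord.
  by rewrite horner_prod; congr (_ * _); apply: eq_bigr => j _; rewrite !hornerE.
have resx j : res P (x j) 2%:R.
  rewrite xE; have -> : 2%:R = 1 ^+ (2 * j + 1) + 1 ^- (2 * j + 1) :> algC.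
    by rewrite expr1n invr1.
  apply: resD; first exact: resXn.
  by apply: resV; [rewrite expr1n oner_neq0 | apply: resXn].
(* The factors [beta - x j] reduce to [beta - 2] and [den] is a unit, while the difference has
   residue 0 because the first sum and [c] both do. *)
have rnat beta : (2 < beta)%N -> res P r.[beta%:R] 0.
  move=> hb; have ux : local_unit P (\prod_(j < n.+1) (beta%:R - x j)).
    apply: local_unit_prod => j _; exists (beta%:R - 2%:R).
      by rewrite subr_eq0 eqr_nat; lia.
    by apply: resB => //; apply: res_nat.
  have uden : local_unit P (den q beta%:R N).
    by apply: local_unit_prod => i _; apply: unit_rho_nat.
  have -> : r.[beta%:R] = den q beta%:R N * (S1 beta%:R - c * S2 beta%:R)
                          / \prod_(j < n.+1) (beta%:R - x j).
    by rewrite -pE ?(local_unit_neq0 uden) // prE mulfK // (local_unit_neq0 ux).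
  have [v v0 hv] := ux; have [u u0 hu] := uden.
  rewrite -(mul0r v^-1) -{1}(mulr0 u); apply: res_div => //; apply: resM => //.
  have [w hw] := local_sum_term_nat resqd simpled n.+1 hb.
  rewrite -{1}(subr0 (0 : algC)) -{2}(mul0r w); apply: resB; first exact: res_full_sum.
  by apply: resM => //; apply: res_cfac.
(* At 2 the factors [b - x j] are no longer units, so the residue of [r] there is interpolated from
   [beta = 3, 4, ..], with [size r] nodes. *)
have r2 : vge P 1 r.[2%:R].
  apply/vge1P; apply: (res0_interp (leqnn (size r)) (x := fun i => (i + 3)%:R)).
  - by move=> i _; exists (i + 3)%:R; apply: res_nat.
  - move=> i j /andP[ij _]; exists ((j + 3)%:R - (i + 3)%:R).
      by rewrite subr_eq0 eqr_nat; lia.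
    by apply: resB; apply: res_nat.
  - by move=> i _; apply: rnat; lia.
  - by exists 2%:R; apply: res_nat.
have p2v : vge P (3 + 2 * n) p.[2%:R].
  rewrite prE (_ : 3 + 2 * n = 1 + 2 * n.+1)%N; last by lia.
  apply: vgeM => //; elim: n.+1 => [|m IH].
    by rewrite big_ord0 muln0; apply/vge0P; exists 1; apply: res1.
  rewrite big_ord_recr mulnSr; apply: vgeM => //=.
  (* With [Q = q^(d(2m+1))], [2 - x m = -(1 - Q)^2 / Q], and [1 - Q] is a simple zero. *)
  have [|y uy yE] := @simpled (2 * m + 1); first by lia.
  exists (- y ^+ 2 / (q ^+ d) ^+ (2 * m + 1)).
    apply: local_div_unit; last by apply: local_unitXn; exists 1; rewrite ?oner_neq0.
    by have [w _ hw] := uy; exists (- w ^+ 2); apply: resN; apply: resXn.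
  have := expf_neq0 (2 * m + 1) qd0; rewrite mulrA mulrN -exprMn -yE xE.
  by move: ((q ^+ d) ^+ (2 * m + 1)) => u u0; field; rewrite u0.
have urest : local_unit P (rest 2%:R).
  apply: local_unit_prod => i di; rewrite rho2; apply: local_unitXn.
  by apply: unit_sub_exp; rewrite dvd4S.
have [u uu uE] := den2_unif simpled n.
have denN0 : den q 2%:R N != 0.
  rewrite denE uE !mulf_neq0 ?expf_neq0 ?unif_neq0 ?(local_unit_neq0 uu) //.
  exact: local_unit_neq0 urest.
have -> : S1 2%:R - c * S2 2%:R = p.[2%:R] / (unif P ^+ (2 * n) * (u * rest 2%:R)).
  by rewrite mulrA -uE -denE pE // [RHS]mulrAC divff // mul1r.
by apply: vge_div => //; apply: local_unitM.
Qed.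

(** [res_full_sum] covers [beta > 2]; at [b = 2] vanishing follows from the congruence, as
    [cfac q d] has residue 0 and the sum over [q^d] is local. *)
Lemma res_sum_term2 n h' : (h <= h' < d)%N ->
  res P (\sum_(k < (d * n + h').+1) term q 2%:R k) 0.
Proof.
move=> /(@dwork_congruence n); set A := \sum_(k < _) term q _ k.
set B := _ * _ => -[y [w hy] yE].
have [v hv] := local_sum_term2 resqd simpled n.+1.
have hu := resXn 3 (res_unif P); rewrite expr0n in hu.
rewrite -(subrK B A) yE -(addr0 (0 : algC)); apply: resD.
  by rewrite -(mul0r w); apply: resM.
by rewrite -(mul0r v); apply: resM => //; apply: res_cfac.
Qed.

End Key.

(** * Cyclotomic places of the rational function field *)

Definition evC (z : algC) (p : {poly rat}) : algC := (map_poly ratr p).[z].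

Definition resC (z : algC) (x : RF) (w : algC) : Prop :=
  exists N D : {poly rat},
    [/\ evC z D != 0, x = toRF N / toRF D & w = evC z N / evC z D].

Section Residue.

Variable z : algC.

Lemma evCB : {morph evC z : p q / p - q}.
Proof. by move=> p q; rewrite /evC rmorphB hornerD hornerN. Qed.

Lemma evCM : {morph evC z : p q / p * q}.
Proof. by move=> p q; rewrite /evC rmorphM hornerM. Qed.

Lemma evC1 : evC z 1 = 1.
Proof. by rewrite /evC rmorph1 hornerC. Qed.

Lemma evCX : evC z 'X = z.
Proof. by rewrite /evC map_polyX hornerX. Qed.

Lemma evC_neq0 p : evC z p != 0 -> p != 0.
Proof. by apply: contra_neq => ->; rewrite /evC rmorph0 horner0. Qed.

Lemma toRF_neq0 (p : {poly rat}) : p != 0 -> toRF p != 0.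
Proof. by rewrite [toRF p == 0]tofrac_eq0. Qed.

Lemma toRFM : {morph toRF : p q / p * q}.
Proof. exact: tofracM. Qed.

Lemma toRFB : {morph toRF : p q / p - q}.
Proof. exact: tofracB. Qed.

Lemma toRFX n : {morph toRF : p / p ^+ n}.
Proof. exact: tofracXn. Qed.

Lemma toRF1 : toRF 1 = 1.
Proof. exact: tofrac1. Qed.

Lemma toRF_inj : injective toRF.
Proof. by move=> p q /eqP; rewrite [_ == _]tofrac_eq => /eqP. Qed.

Lemma subf_div (F : fieldType) (a b c d : F) : b != 0 -> d != 0 ->
  a / b - c / d = (a * d - c * b) / (b * d).
Proof. by move=> b0 d0; field; rewrite b0 d0. Qed.

Lemma resC_toRF p : resC z (toRF p) (evC z p).
Proof.
exists p, 1; rewrite evC1 oner_neq0; split=> //; last by rewrite divr1.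
by rewrite toRF1 divr1.
Qed.

Lemma resC1 : resC z 1 1.
Proof. by have := resC_toRF 1; rewrite evC1 toRF1. Qed.

Lemma resCB x y v w : resC z x v -> resC z y w -> resC z (x - y) (v - w).
Proof.
move=> [N [D [D0 -> ->]]] [N' [D' [D0' -> ->]]].
exists (N * D' - N' * D), (D * D'); rewrite evCB !evCM mulf_neq0 //; split=> //.
  rewrite toRFB !toRFM subf_div ?toRF_neq0 //.
    exact: evC_neq0 D0.
  exact: evC_neq0 D0'.
by rewrite subf_div.
Qed.

Lemma resCM x y v w : resC z x v -> resC z y w -> resC z (x * y) (v * w).
Proof.
move=> [N [D [D0 -> ->]]] [N' [D' [D0' -> ->]]].
exists (N * N'), (D * D'); rewrite !evCM mulf_neq0 //; split=> //.
  by rewrite !toRFM invfM mulrACA.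
by rewrite invfM mulrACA.
Qed.

Lemma resCV x v : v != 0 -> resC z x v -> resC z x^-1 v^-1.
Proof.
move=> v0 [N [D [D0 xE vE]]]; move: v0; rewrite vE => v0.
exists D, N; rewrite xE !invf_div; split=> //.
by move: v0; apply: contra_neq => ->; rewrite mul0r.
Qed.

Lemma resC_inj x v w : resC z x v -> resC z x w -> v = w.
Proof.
move=> [N [D [D0 -> ->]]] [N' [D' [D0' xE ->]]].
apply/eqP; rewrite eqr_div // -!evCM; apply/eqP; congr evC.
apply: toRF_inj; apply/eqP.
rewrite !toRFM -eqr_div ?toRF_neq0 ?(evC_neq0 D0) ?(evC_neq0 D0') //.
exact/eqP.
Qed.

Lemma resC_qX : resC z qX z.
Proof. by have := resC_toRF 'X; rewrite evCX. Qed.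

End Residue.

Section Cyclotomic.

Variables (D : nat) (z : algC).
Hypothesis primz : D.-primitive_root z.

Let pi : RF := toRF (Phi D).

(** [Phi D] is the minimal polynomial of [z] over the rationals. *)
Lemma dvd_Phi p : (Phi D %| p) = (evC z p == 0).
Proof.
have [pf [Dpf mon_pf] dv_pf] := minCpolyP z.
have -> : Phi D = pf.
  apply: (map_inj_poly (fmorph_inj (@ratr algC)) (rmorph0 _)).
  rewrite -Dpf (minCpoly_cyclotomic primz) -(Cintr_Cyclotomic primz) /Phi.
  rewrite -map_poly_comp; apply: eq_map_poly => a /=; exact: ratr_int.
by rewrite -dv_pf.
Qed.

Lemma Phi_neq0 : Phi D != 0.
Proof.
rewrite /Phi -size_poly_eq0 size_map_inj_poly //; last exact: intr_inj.
by rewrite size_poly_eq0 monic_neq0 // Cyclotomic_monic.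
Qed.

Lemma evC_Phi : evC z (Phi D) = 0.
Proof. by apply/eqP; rewrite -dvd_Phi. Qed.

Lemma pi_neq0 : pi != 0.
Proof. exact/toRF_neq0/Phi_neq0. Qed.

Lemma res_pi : resC z pi 0.
Proof. by rewrite -evC_Phi; apply: resC_toRF. Qed.

(** The gcd divides [p], so it does not vanish at [z]; hence its cofactor in [Phi D] does and is a
    multiple of [Phi D], which makes the gcd constant. *)
Lemma coprime_Phi p : evC z p != 0 -> coprimep p (Phi D).
Proof.
move=> p0; have /dvdpP[s Ps] := dvdp_gcdr p (Phi D).
have /dvdpP[r pr] := dvdp_gcdl p (Phi D).
have g0 : evC z (gcdp p (Phi D)) != 0.
  by move: p0; rewrite {1}pr evCM mulf_eq0; case: eqP => // ->; rewrite orbT.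
have h : Phi D %| s.
  by rewrite dvd_Phi; have := evC_Phi; rewrite {1}Ps evCM => /eqP;
     rewrite mulf_eq0 (negbTE g0) orbF.
have s0 : s != 0.
  by move: Phi_neq0; rewrite {1}Ps; apply: contra_neq => ->; rewrite mul0r.
by rewrite /coprimep -dvdp1 -(dvdp_mul2l _ _ s0) mulr1 -Ps.
Qed.

Lemma resC0_pi x : resC z x 0 -> exists y w, resC z y w /\ x = pi * y.
Proof.
move=> [N [Dn [D0 -> /eqP]]].
rewrite eq_sym mulf_eq0 invr_eq0 (negbTE D0) orbF -dvd_Phi => /dvdpP[s ->].
exists (toRF s / toRF Dn), (evC z s / evC z Dn); split; first by exists s, Dn.
by rewrite toRFM mulrCA mulrA.
Qed.

Definition cyclotomic_place : place RF algC :=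
  Place (resC1 z) (@resCB z) (@resCM z) (@resCV z) (@resC_inj z)
    pi_neq0 res_pi resC0_pi.

Let P := cyclotomic_place.

Lemma vge_coprime e x : vge P e x ->
  exists N Dn : {poly rat},
    [/\ coprimep Dn (Phi D), Dn != 0, Phi D ^+ e %| N & x = toRF N / toRF Dn].
Proof.
move=> [y [w [N [Dn [D0 -> _]]]] ->]; exists (Phi D ^+ e * N), Dn.
split; [exact: coprime_Phi | exact: evC_neq0 D0 | exact: dvdp_mulIl | ].
by rewrite toRFM mulrA toRFX.
Qed.

(** If the cofactor of [Phi D] in [1 - X^s] also vanished at [z], so would the derivative
    [-s z^(s-1)]. *)
Lemma pi_simple s : (0 < s)%N -> (D %| s)%N ->
  exists2 y, local_unit P y & 1 - qX ^+ s = unif P * y.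
Proof.
move=> s0 dvs; have zs : z ^+ s = 1 by apply/eqP; rewrite -(prim_order_dvd primz).
have : Phi D %| 1 - 'X^s.
  by rewrite dvd_Phi /evC rmorphB /= rmorph1 map_polyXn !hornerE zs subrr.
move=> /dvdpP[W WE]; exists (toRF W); last first.
  by rewrite mulrC -toRFM -WE toRFB toRF1 toRFX.
exists (evC z W); last exact: resC_toRF.
have dE : (map_poly ratr (1 - 'X^s : {poly rat}))^`().[z] = - (s%:R * z ^+ s.-1) :> algC.
  rewrite rmorphB /= rmorph1 map_polyXn derivB derivXn derivC sub0r hornerN.
  by rewrite hornerMn hornerXn mulr_natl.
apply/eqP => W0; move: dE; rewrite WE rmorphM derivM hornerD !hornerM.
rewrite -/(evC z (Phi D)) -/(evC z W) W0 evC_Phi mul0r mulr0 addr0 => /esym/eqP.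
rewrite oppr_eq0 mulf_eq0 pnatr_eq0 expf_eq0 => /orP[|/andP[_ /eqP z0]]; first lia.
by move: zs; rewrite z0 expr0n; case: s s0 {dvs WE} => // s _ /esym/eqP; rewrite oner_eq0.
Qed.

End Cyclotomic.

(** * Gluing over the divisors of [n ^ r] *)

(** The inclusive upper limits of the two congruences of the theorem; the flag lets one argument
    treat both. *)
Definition upper (full : bool) (m : nat) : nat :=
  if full then (m - 1)%N else ((m - 1) %/ 2)%N.

Definition qsum (F : fieldType) (q : F) (N : nat) : F := \sum_(k < N.+1) term q 2%:R k.

Lemma odd_half_eq m : odd m -> (m = 2 * m./2 + 1)%N.
Proof. by move=> om; rewrite -[LHS]odd_double_half om; lia. Qed.

(** This is the shape [d * n + h'] of the limits in [dwork_congruence]. *)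
Lemma upperM full d m : odd d -> odd m ->
  upper full (d * m) = (d * upper full m + upper full d)%N.
Proof.
move=> /odd_half_eq; move: d./2 => e -> /odd_half_eq; move: m./2 => f ->.
rewrite /upper; case: full; first by nia.
rewrite !addnK !mulKn // (_ : _ - 1 = 2 * ((2 * e + 1) * f + e))%N ?mulKn //.
by nia.
Qed.

Lemma upper_bounds full d : odd d -> (d./2 <= upper full d < d)%N.
Proof.
move=> /[dup] /odd_half_eq; move: d./2 => e -> _.
by rewrite /upper; case: full; rewrite addnK ?mulKn //; lia.
Qed.

(** * The congruence for the base [q^t] at a cyclotomic place *)

Section AtRootOfUnity.

Variables (D t d : nat) (z : algC).
Hypotheses (primz : D.-primitive_root z) (primzt : d.-primitive_root (z ^+ t)).
Hypotheses (tgt0 : (0 < t)%N) (dodd : odd d) (dgt1 : (1 < d)%N).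

Let P := cyclotomic_place primz.

Lemma resP_qXn s : res P (qX ^+ s) (z ^+ s).
Proof. by apply: resXn; exact: resC_qX. Qed.

Lemma simple_qXn j : (0 < j)%N ->
  exists2 y, local_unit P y & 1 - (qX ^+ t) ^+ (d * j) = unif P * y.
Proof.
move=> j0; rewrite -exprM; apply: pi_simple; first by rewrite !muln_gt0 tgt0 j0; lia.
by rewrite (prim_order_dvd primz) mulnA exprM exprM (prim_expr_order primzt) expr1n.
Qed.

Lemma vge_qsum full m : odd m ->
  vge P 3 (qsum (qX ^+ t) (upper full (d * m))
           - cfac (qX ^+ t) d * qsum (qX ^+ (t * d)) (upper full m)).
Proof.
move=> om; rewrite upperM // exprM.
apply: (dwork_congruence primzt (resP_qXn t) dodd dgt1 simple_qXn).
exact: upper_bounds.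
Qed.

Lemma res_qsum full m : odd m -> res P (qsum (qX ^+ t) (upper full (d * m))) 0.
Proof.
move=> om; rewrite upperM //.
apply: (res_sum_term2 primzt (resP_qXn t) dodd dgt1 simple_qXn).
exact: upper_bounds.
Qed.

End AtRootOfUnity.

(** * The difference of the two sides at each divisor of [n ^ r] *)

Section Assembly.

Variables (n r : nat) (full : bool).
Hypotheses (nodd : odd n) (ngt1 : (1 < n)%N) (rgt0 : (0 < r)%N).

Definition dwork_diff : RF :=
  qsum qX (upper full (n ^ r)) - cfac qX n * qsum (qX ^+ n) (upper full (n ^ r.-1)).

Section Divisor.

Variables (D : nat) (z : algC).
Hypotheses (primz : D.-primitive_root z).

Let P := cyclotomic_place primz.

Lemma local_cfac m : local P (cfac qX m).
Proof.
have lq : local P qX by exists z; apply: (resC_qX z).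
apply: localM; last exact: local_qint.
exists ((- z) ^+ ((m - 1) %/ 2))^-1; apply: resV.
  by rewrite expf_neq0 // oppr_eq0 (prim_neq0 primz).
by apply/resXn/resN; apply: (resC_qX z).
Qed.

(** The left sum vanishes by [res_qsum]. On the right, if [D | n] then [[n]] vanishes and the sum is
    local; otherwise [q^n] reduces to a root of unity of order [d = D / gcd(n, D) > 1] and the sum
    vanishes, since [d | n^(r-1)]. *)
Lemma res_dwork_diff : (D %| n ^ r)%N -> (1 < D)%N -> res P dwork_diff 0.
Proof.
move=> /dvdnP[m mE] Dgt1.
have onr s : odd (n ^ s) by rewrite oddX nodd orbT.
have [om oD] : odd m /\ odd D by apply/andP; rewrite -oddM -mE.
have res_q : res P qX z by apply: (resC_qX z).
rewrite /dwork_diff -(subr0 (0 : algC)); apply: resB.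
  have := @res_qsum D 1 D z primz; rewrite !expr1 => /(_ primz isT oD Dgt1 full m om).
  by rewrite mE mulnC.
have [w hw] := local_cfac n.
have [Dn|nDn] := boolP (D %| n)%N.
  have zn : z ^+ n = 1 by apply/eqP; rewrite -(prim_order_dvd primz).
  have [v hv] : local P (qsum (qX ^+ n) (upper full (n ^ r.-1))).
    apply: local_sum_term2; first by rewrite -zn; apply: resXn.
    move=> j j0; rewrite -exprM; apply: pi_simple; first by rewrite muln_gt0 j0; lia.
    by rewrite dvdn_mulr.
  rewrite -(mul0r v); apply: resM => //.
  apply: (res_cfac primz res_q oD Dgt1) => //.
rewrite -(mulr0 w); apply: resM => //.
pose d := (D %/ gcdn n D)%N.
have D0 : (0 < D)%N by lia.
have g0 : (0 < gcdn n D)%N by rewrite gcdn_gt0 D0 orbT.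
have dE : (d * gcdn n D)%N = D by rewrite divnK ?dvdn_gcdr.
have dgt1 : (1 < d)%N.
  have d0 : (0 < d)%N by rewrite divn_gt0 // dvdn_leq // dvdn_gcdr.
  suff : d != 1%N by lia.
  by apply: contra nDn => /eqP d1; rewrite -dE d1 mul1n dvdn_gcdl.
(* Cancelling the gcd in [D | n * n^(r-1)] gives [d | (n / gcd) * n^(r-1)], and [d] is prime to
   [n / gcd]. *)
have dn : (d %| n ^ r.-1)%N.
  have nE : (n %/ gcdn n D * gcdn n D)%N = n by rewrite divnK ?dvdn_gcdl.
  have co : coprime d (n %/ gcdn n D).
    by rewrite /coprime -(eqn_pmul2r g0) mul1n muln_gcdl dE nE gcdnC.
  rewrite -(Gauss_dvdr _ co) -(dvdn_pmul2r g0) dE mulnAC nE -expnS prednK // mE.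
  exact: dvdn_mull.
have /dvdnP[m' m'E] := dn.
have [om' od] : odd m' /\ odd d by apply/andP; rewrite -oddM -m'E.
rewrite m'E mulnC; apply: (res_qsum primz) => //; last by lia.
exact: exp_prim_root.
Qed.

End Divisor.

(** [A] compares the sum over [q], and [B] the sum over [q^n], with the sum over [q^(n^j)]; by
    [cfacM] the latter cancels from [A - cfac qX n * B]. For [j = 1], [A] alone is the claim. *)
Lemma vge_dwork_diff j z (primz : (n ^ j)%N.-primitive_root z) :
  (0 < j <= r)%N -> vge (cyclotomic_place primz) 3 dwork_diff.
Proof.
case: j primz => // j primz /= jr; set P := cyclotomic_place primz.
have onr s : odd (n ^ s) by rewrite oddX nodd orbT.
have gt1 s : (0 < s)%N -> (1 < n ^ s)%N by move=> s0; rewrite -(expn0 n) ltn_exp2l.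
pose m := (n ^ (r - j.+1))%N.
have A : vge P 3 (qsum qX (upper full (n ^ r))
    - cfac qX (n ^ j.+1) * qsum (qX ^+ (n ^ j.+1)) (upper full m)).
  have := @vge_qsum (n ^ j.+1) 1 (n ^ j.+1) z primz.
  rewrite !expr1 mul1n => /(_ primz isT (onr _) (gt1 j.+1 isT) full m (onr _)).
  by rewrite -expnD subnKC.
have [j0|j0] := posnP j.
  by move: A; rewrite /m j0 expn1 subn1.
have primzn : (n ^ j)%N.-primitive_root (z ^+ n).
  have := exp_prim_root primz n; rewrite expnS gcdnMr mulKn //; lia.
have B : vge P 3 (qsum (qX ^+ n) (upper full (n ^ r.-1))
    - cfac (qX ^+ n) (n ^ j) * qsum (qX ^+ (n ^ j.+1)) (upper full m)).
  have := @vge_qsum _ n _ z primz primzn (ltnW ngt1) (onr _) (gt1 _ j0) full m (onr _).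
  by rewrite -expnD -expnS (_ : j + (r - j.+1) = r.-1)%N //; lia.
have q1 s : (0 < s)%N -> 1 - qX ^+ s != 0.
  (* Nonvanishing is read off at the place of [Phi 1], a simple factor of [1 - q^s]. *)
  move=> s0; have [z1 primz1] := C_prim_root_exists (ltn0Sn 0).
  have [y /local_unit_neq0 y0] := pi_simple primz1 s0 (dvd1n s).
  by move=> ->; rewrite mulf_neq0 ?unif_neq0.
have cE : cfac qX (n ^ j.+1) = cfac qX n * cfac (qX ^+ n) (n ^ j).
  by rewrite expnS cfacM ?q1 //; [have := q1 1%N isT; rewrite expr1 | lia].
have -> : dwork_diff = (qsum qX (upper full (n ^ r))
     - cfac qX (n ^ j.+1) * qsum (qX ^+ (n ^ j.+1)) (upper full m))
  - cfac qX n * (qsum (qX ^+ n) (upper full (n ^ r.-1))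
    - cfac (qX ^+ n) (n ^ j) * qsum (qX ^+ (n ^ j.+1)) (upper full m)).
  rewrite /dwork_diff cE.
  move: (qsum _ _) (cfac _ _) (cfac _ _) (qsum _ _) (qsum _ _) => s c c' s' s''.
  by rewrite mulrBr mulrA opprB addrA addrNK.
by apply: vgeB => //; apply: vgeMl => //; apply: local_cfac.
Qed.

End Assembly.

(** * From valuations back to the stated congruences *)

Lemma summandE q k : summand q k = term q 2%:R k.
Proof.
rewrite /summand /term -!mulrA; congr (_ * (_ * _)).
rewrite /qpoch -!prodrXl -prodfV -!big_split /=; apply: eq_bigr => i _.
rewrite /tfac !rho2.
have -> : q * (q ^+ 2) ^+ i = q ^+ (2 * i + 1) by rewrite -exprM -exprS addn1.
have -> : q ^+ 2 * (q ^+ 4) ^+ i = q ^+ (4 * i + 2) by rewrite -exprM -exprD addnC.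
have -> : q ^+ 4 * (q ^+ 4) ^+ i = q ^+ (4 * i + 4) by rewrite -exprM -exprD addnC.
by rewrite mulrA -expr2 mulrA -exprSr.
Qed.

(** Each place supplies its own fraction; a reduced one will serve all [Phi D] at once. *)
Lemma fraction_reduced (N D : {poly rat}) : D != 0 ->
  exists N' D' : {poly rat},
    [/\ coprimep N' D', D' != 0 & toRF N / toRF D = toRF N' / toRF D'].
Proof.
move=> D0; have g0 : gcdp N D != 0 by rewrite gcdp_eq0 negb_and D0 orbT.
have D'0 : D %/ gcdp N D != 0.
  by apply: contra_neq D0 => e; rewrite -(divpK (dvdp_gcdr N D)) e mul0r.
exists (N %/ gcdp N D), (D %/ gcdp N D); split=> //.
  by apply: coprimep_div_gcd; rewrite D0 orbT.
apply/eqP; rewrite eqr_div ?toRF_neq0 // -!toRFM; apply/eqP; congr toRF.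
by rewrite divp_mulA ?dvdp_gcdr // divp_mulAC ?dvdp_gcdl.
Qed.

(** A common root would be a primitive root of unity of both orders. *)
Lemma coprime_Phi_Phi (m k : nat) : (0 < m)%N -> m != k ->
  coprimep (Phi k) (Phi m).
Proof.
move=> m0 mk; have [z primz] := C_prim_root_exists m0.
apply: (coprime_Phi primz); apply/eqP => zk; have [k0|k0] := posnP k.
  (* By convention ['Phi_0] is 1. *)
  move: zk; rewrite k0 /Phi Cyclotomic0 rmorph1 evC1.
  by move/eqP; rewrite oner_eq0.
have [y primy] := C_prim_root_exists k0.
have : root (cyclotomic y k) z.
  rewrite -(Cintr_Cyclotomic primy) rootE; apply/eqP; rewrite -[RHS]zk /evC /Phi.
  by rewrite -map_poly_comp; congr (_.[z]); apply: eq_map_poly => a /=; rewrite ratr_int.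
rewrite root_cyclotomic // => primzk; case/eqP: mk; apply/eqP.
by rewrite eqn_dvd (prim_order_dvd primz) (prim_order_dvd primzk) !prim_expr_order ?eqxx.
Qed.

Lemma dvdp_prod_coprime (I : eqType) (s : seq I) (f : I -> {poly rat}) N :
  uniq s -> {in s &, forall i j, i != j -> coprimep (f i) (f j)} ->
  {in s, forall i, f i %| N} -> \prod_(i <- s) f i %| N.
Proof.
elim: s => [|i s IH] /=; first by rewrite big_nil dvd1p.
move=> /andP[nis us] co dv; rewrite big_cons Gauss_dvdp.
  rewrite dv ?mem_head //=; apply: IH => //.
    by move=> j k js ks; apply: co; rewrite inE ?js ?ks orbT.
  by move=> j js; apply: dv; rewrite inE js orbT.
rewrite big_seq; elim/big_rec: _ => [|j p js cop]; first by rewrite coprimep1.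
rewrite coprimepMr cop andbT; apply: co; rewrite ?mem_head // ?inE ?js ?orbT //.
by apply: contraNneq nis => ->.
Qed.

(** [qcong] asks for one fraction for the whole modulus; it is obtained by reducing the one at [D0].
    By [N' * Dn = N * D'] its denominator [Dn] divides each local denominator [D'], hence is prime
    to every [Phi D], and the power of [Phi D] in [N'] passes to [N]. *)
Lemma qcong_divisors (A B : RF) (s : seq nat) (e : nat -> nat) D0 :
  uniq s -> D0 \in s -> {in s, forall D, (0 < D)%N} ->
  {in s, forall D z (primz : D.-primitive_root z),
     vge (cyclotomic_place primz) (e D) (A - B)} ->
  qcong A B (\prod_(D <- s) Phi D ^+ e D).
Proof.
move=> us D0s s0 h; have [z0 primz0] := C_prim_root_exists (s0 D0 D0s).
have [N0 [Dn0 [_ Dn00 _ ABE0]]] := vge_coprime (h D0 D0s z0 primz0).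
have [N [Dn [co Dn_neq0 ABE]]] := fraction_reduced N0 Dn00; rewrite -ABE0 in ABE.
have hD D : D \in s -> coprimep Dn (Phi D) /\ Phi D ^+ e D %| N.
  move=> Ds; have [z primz] := C_prim_root_exists (s0 D Ds).
  have [N' [D' [coD' D'0 dvN' ABE']]] := vge_coprime (h D Ds z primz).
  have E : N' * Dn = N * D'.
    apply: toRF_inj; rewrite !toRFM; apply/eqP.
    by rewrite -eqr_div ?toRF_neq0 // -ABE -ABE'.
  have dvD : Dn %| D'.
    by rewrite -(@Gauss_dvdpr _ D' N) 1?coprimep_sym // -E dvdp_mulIr.
  split; first exact: coprimep_dvdr dvD coD'.
  rewrite -(@Gauss_dvdpl _ N D'); last by apply: coprimep_expl; rewrite coprimep_sym.
  by rewrite -E dvdp_mulr.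
exists N, Dn; split=> //.
- apply: dvdp_prod_coprime => // [i j is_ js ij|D /hD[]] //.
  by apply/coprimep_expl/coprimep_expr/coprime_Phi_Phi; rewrite ?s0 // eq_sym.
- rewrite big_seq; elim/big_rec: _ => [|D p /hD[coD _] cop]; first by rewrite coprimep1.
  by rewrite coprimepMr cop andbT; apply: coprimep_expr.
Qed.

Lemma prod_Phi m : (0 < m)%N ->
  \prod_(D <- divisors m | D != 1%N) Phi D = qint 'X m.
Proof.
move=> m0; have X1 : ('X - 1 : {poly rat}) != 0 by rewrite -polyC1 polyXsubC_eq0.
have PhiX k : (0 < k)%N -> \prod_(D <- divisors k) Phi D = 'X^k - 1.
  move=> k0; rewrite /Phi -rmorph_prod (prod_Cyclotomic k0).
  by rewrite rmorphB /= rmorph1 map_polyXn.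
apply: (mulfI X1); rewrite -subrX1 -PhiX // [RHS](bigD1_seq 1%N) ?divisors_uniq //=; last first.
  exact: divisor1.
congr (_ * _); have := PhiX 1%N isT; by rewrite big_cons big_nil mulr1 expr1 => ->.
Qed.

Lemma qcong_dwork (n r : nat) (full : bool) :
  odd n -> (1 < n)%N -> (0 < r)%N ->
  qcong (qsum qX (upper full (n ^ r)))
        (cfac qX n * qsum (qX ^+ n) (upper full (n ^ r.-1)))
        (qint 'X (n ^ r) * \prod_(1 <= j < r.+1) Phi (n ^ j) ^+ 2).
Proof.
move=> on n1 r0; have nr0 : (0 < n ^ r)%N by rewrite expn_gt0; lia.
pose s := [seq D <- divisors (n ^ r) | D != 1%N].
pose pw := [seq (n ^ j)%N | j <- index_iota 1 r.+1].
have pw_s : {subset pw <= s}.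
  move=> D /mapP[j]; rewrite mem_index_iota => /andP[j0 jr] ->.
  rewrite mem_filter -dvdn_divisors // dvdn_exp2l // andbT.
  by rewrite -(expn0 n) eqn_exp2l // -lt0n.
have us : uniq s by rewrite filter_uniq // divisors_uniq.
have upw : uniq pw.
  rewrite map_inj_in_uniq ?iota_uniq // => i j _ _ /eqP.
  by rewrite eqn_exp2l // => /eqP.
(* [[n^r]] contributes one [Phi D] for each divisor [D > 1], so the powers [n^j] get exponent 3 and
   the other divisors exponent 1. *)
have -> : qint 'X (n ^ r) * \prod_(1 <= j < r.+1) Phi (n ^ j) ^+ 2
  = \prod_(D <- s) Phi D ^+ (if D \in pw then 3 else 1).
  rewrite -prod_Phi // -big_filter -/s.
  have -> : \prod_(1 <= j < r.+1) Phi (n ^ j) ^+ 2 = \prod_(D <- s | D \in pw) Phi D ^+ 2.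
    rewrite -(big_map (fun j => n ^ j)%N xpredT (fun D => Phi D ^+ 2)) -/pw -[RHS]big_filter.
    apply: perm_big; apply: uniq_perm => // [|D]; first by rewrite filter_uniq.
    by rewrite mem_filter; case: (boolP (D \in pw)) => // /pw_s ->.
  rewrite [X in _ * X]big_mkcond -big_split /=; apply: eq_bigr => D _.
  by case: ifP; rewrite ?mulr1 // -exprS.
apply: (@qcong_divisors _ _ _ _ (n ^ r)%N) => // [|D|D Ds z primz].
  by rewrite mem_filter -dvdn_divisors // dvdnn andbT -(expn0 n) eqn_exp2l // -lt0n.
  by rewrite mem_filter -dvdn_divisors // => /andP[_ /dvdn_gt0]; apply.
case: ifP => [/mapP[j]|_].
  rewrite mem_index_iota ltnS => jr DE; subst D.
  exact: vge_dwork_diff.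
move: Ds; rewrite mem_filter -dvdn_divisors // => /andP[D1 Dnr].
apply/vge1P; apply: res_dwork_diff => //.
by have := dvdn_gt0 nr0 Dnr; lia.
Qed.

Unset Implicit Arguments.

Theorem theorem1p2 (n r : nat) :
  odd n -> (1 < n)%N -> (1 <= r)%N ->
  let M : {poly rat} :=
    qint 'X (n ^ r) * \prod_(1 <= j < r.+1) (Phi (n ^ j)) ^+ 2 in
  let c : RF := (- qX) ^- ((n - 1) %/ 2) * qint qX n in
  qcong (\sum_(k < ((n ^ r - 1) %/ 2).+1) summand qX k)
        (c * \sum_(k < ((n ^ r.-1 - 1) %/ 2).+1) summand (qX ^+ n) k) M
  /\
  qcong (\sum_(k < n ^ r) summand qX k)
        (c * \sum_(k < n ^ r.-1) summand (qX ^+ n) k) M.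
Proof.
move=> on n1 r0 M c.
have sumE q N : \sum_(k < N.+1) summand q k = qsum q N.
  by apply: eq_bigr => k _; apply: summandE.
split; first by rewrite !sumE; apply: (qcong_dwork false).
have n0 s : (n ^ s = (n ^ s - 1).+1)%N by rewrite subn1 prednK // expn_gt0; lia.
rewrite (n0 r) (n0 r.-1) !sumE; exact: (qcong_dwork true).
Qed.
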